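(* Let $A$ be a bi-Koszul algebra and $M\in Gr_0(A)$. Then: (1) If $\mathsf{E}(M)$ is generated by $\mathsf{E}^0(M)$ as an $E(A)$-module, then $M$ is a bi-Koszul module. (2) If $M$ is a strongly bi-Koszul module, then $\mathsf{E}(M)$ is generated by $\mathsf{E}^0(M)$ as an $E(A)$-module.
   Context: Fix a field $\mathbb{F}$. $A=k\oplus A_1\oplus A_2\oplus\cdots$ denotes an associative graded $\mathbb{F}$-algebra, where $k=A_0$ is a semisimple Artin algebra over $\mathbb{F}$, $A_1$ is a finitely generated $\mathbb{F}$-module, and $A$ is generated in degrees $0$ and $1$. $J=A_1\oplus A_2\oplus\cdots$ is the graded Jacobson radical and $k=A/J$ is the trivial left $A$-module. $Gr(A)$ is the category of graded left $A$-modules with degree-zero morphisms; $Gr_0(A)$ is its full subcategory of modules generated in degree $0$. Shift: $M(n)_j=M_{j-n}$. $\underline{\mathrm{Ext}}^*_A$ is the derived functor of $\underline{\mathrm{Hom}}_A(M,N)=\bigoplus_n\mathrm{Hom}_{Gr(A)}(M,N(n))$. Put $E(A)=\underline{\mathrm{Ext}}^*_A(k,k)$ and $\mathsf{E}(M)=\underline{\mathrm{Ext}}^*_A(M,k)$, a left $E(A)$-module by the Yoneda product. For $M$ with minimal graded projective resolution $\cdots\to Q_1\xrightarrow{\partial_1}Q_0\xrightarrow{\partial_0}M\to0$, $\Omega^n(M)=\ker\partial_{n-1}$ is the $n$-th syzygy ($\Omega^0(M)=M$). Fix an integer $d\ge2$. Let $\Delta(3m)=\{2md\}$, $\Delta(3m+1)=\{2md+1\}$,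 $\Delta(3m+2)=\{2md+d,\,2md+d+1\}$ for $m\ge0$. ''Generated in degrees $S$'' means generated by homogeneous elements with degrees in $S$. $A$ is a bi-Koszul algebra if the $n$-th term $P_n$ of a minimal graded projective resolution of the trivial left module $k$ is generated in degrees $\Delta(n)$, for all $n\ge0$. Over a bi-Koszul algebra $A$, $M\in Gr(A)$ is a bi-Koszul module if the $n$-th term $Q_n$ of a minimal graded projective resolution of $M$ is generated in degrees $\Delta(n)$, for all $n\ge0$. A bi-Koszul module $M\in Gr_0(A)$ is strongly bi-Koszul if for all $n\ge0$, $J\Omega^{3n+2}(M)=J\Omega^{3n+2}(M/JM)\cap\Omega^{3n+2}(M)$. Here $\Omega^1(M)\subseteq\Omega^1(M/JM)$ are both submodules of $Q_0$ (a projective cover of both $M$ and $M/JM$), and $\Omega^{i}(M)$ is regarded inductively as a submodule of $\Omega^{i}(M/JM)$ via the map induced by lifting $M\to M/JM$ (with the identity on $Q_0$) to minimal projective resolutions. *)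

(* Defs.v *)
From HB Require Import structures.
From mathcomp Require Import all_boot all_order all_algebra generic_quotient ring_quotient.
From mathcomp Require Import boolp classical_sets.

Set Implicit Arguments.
Unset Strict Implicit.
Unset Printing Implicit Defensive.

Import Order.TTheory GRing.Theory Num.Theory.
Local Open Scope classical_set_scope.
Local Open Scope ring_scope.

Definition additive_subgroup (V : zmodType) (S : set V) : Prop :=
  S 0 /\ forall x y, S x -> S y -> S (x - y).

Lemma additive_subgroupD (V : zmodType) (S : set V) :
  additive_subgroup S -> forall x y, S x -> S y -> S (x + y).
Proof.
move=> [S0 SB] x y Sx Sy; rewrite -[y]opprK; apply: (SB _ _ Sx).
by rewrite -sub0r; apply: SB S0 Sy.
Qed.

Definition internal_direct_sum (I : eqType) (V : zmodType) (G : I -> set V) : Prop :=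
  [/\ forall i, additive_subgroup (G i),
      forall x, exists (s : seq I) (f : I -> V),
        (forall i, G i (f i)) /\ x = \sum_(i <- s) f i
    & forall (s : seq I) (f : I -> V), uniq s -> (forall i, G i (f i)) ->
        \sum_(i <- s) f i = 0 -> forall i, i \in s -> f i = 0].

Definition fin_dim (F : fieldType) (V : lmodType F) (S : set V) : Prop :=
  exists (n : nat) (e : 'I_n -> V), (forall i, S (e i)) /\
    forall x, S x -> exists c : 'I_n -> F, x = \sum_i c i *: e i.

Record gralg (F : fieldType) := GrAlg {
  gralg_sort :> algType F;
  acomp : nat -> set gralg_sort;
  acomp_sum : internal_direct_sum acomp;
  acompZ : forall i (c : F) a, acomp i a -> acomp i (c *: a);
  acomp1 : acomp 0%N 1;
  acompM : forall i j a b, acomp i a -> acomp j b -> acomp (i + j)%N (a * b)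
}.

Section Algebra.
Variables (F : fieldType) (A : gralg F).

Definition left_ideal0 (I : set A) : Prop :=
  [/\ I `<=` @acomp F A 0%N, additive_subgroup I
    & forall a x, @acomp F A 0%N a -> I x -> I (a * x)].

(* The ring A_0 is semisimple: every left ideal of A_0 is a direct summand of
   A_0 as a left A_0-module. *)
Definition semisimple0 : Prop :=
  forall I, left_ideal0 I -> exists I', [/\ left_ideal0 I', I `&` I' = [set 0]
    & forall a, @acomp F A 0%N a -> exists x y, [/\ I x, I' y & a = x + y]].

Definition generated01 : Prop :=
  forall S : set A, @acomp F A 0%N `<=` S -> @acomp F A 1%N `<=` S ->
    (forall a b, S a -> S b -> S (a + b)) ->
    (forall a b, S a -> S b -> S (a * b)) -> S = setT.

(* An Artin algebra over the field F is a finite-dimensional F-algebra. *)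
Definition standing_assumptions : Prop :=
  [/\ semisimple0, fin_dim (@acomp F A 0%N), fin_dim (@acomp F A 1%N)
    & generated01].

Definition radJ : set A := [set a | exists (n : nat) (f : nat -> A),
  (forall i, @acomp F A i.+1 (f i)) /\ a = \sum_(i < n) f i].

Definition smul_set (M : lmodType A) (I : set A) (X : set M) : set M :=
  [set x | exists (n : nat) (a : 'I_n -> A) (m : 'I_n -> M),
    (forall i, I (a i) /\ X (m i)) /\ x = \sum_i a i *: m i].

Record grmod := GrMod {
  grmod_sort :> lmodType A;
  mcomp : int -> set grmod_sort;
  mcomp_sum : internal_direct_sum mcomp;
  mcompZ : forall i j a x, @acomp F A i a -> mcomp j x -> mcomp (i%:Z + j) (a *: x)
}.

Definition gr_hom (M N : grmod) (f : M -> N) : Prop :=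
  linear f /\ forall j x, @mcomp M j x -> @mcomp N j (f x).

(* The shift: M(n)_j = M_{j-n}. *)
Section Shift.
Variables (M : grmod) (n : int).

Definition shift_comp (j : int) : set M := @mcomp M (j - n).

Lemma shift_sum : internal_direct_sum shift_comp.
Proof.
have [gM decM unM] := mcomp_sum M; split => [i|x|s f us fM sf0].
- exact: gM.
- have [s [f [fM ->]]] := decM x.
  exists [seq i + n | i <- s], (fun j => f (j - n)); split=> [i|]; first exact: fM.
  by rewrite big_map; apply: eq_bigr => i _; rewrite addrK.
- have us' : uniq [seq i - n | i <- s] by rewrite map_inj_uniq //; exact: addIr.
  move=> i si; rewrite -[i](subrK n).
  apply: (unM [seq i - n | i <- s] (fun j => f (j + n)) us') => [j||].
  + by have := fM (j + n); rewrite /shift_comp addrK.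
  + by rewrite big_map; under eq_bigr do rewrite subrK.
  + by apply/mapP; exists i.
Qed.

Lemma shiftZ i j a x :
  @acomp F A i a -> shift_comp j x -> shift_comp (i%:Z + j) (a *: x).
Proof. by move=> ai xj; rewrite /shift_comp -addrA; apply: mcompZ. Qed.

Definition shift : grmod := GrMod shift_sum shiftZ.
End Shift.

(* The elements of \underline{Hom}_A(M, N), the direct sum over n of the
   Hom_{Gr(A)}(M, N(n)): finite sums of homogeneous A-linear maps. *)
Definition uHom (M N : grmod) (f : M -> N) : Prop :=
  exists (s : seq int) (g : int -> M -> N),
    (forall n, @gr_hom M (shift N n) (g n)) /\
    forall x, f x = \sum_(n <- s) g n x.

Section Regular.

Definition reg_comp (j : int) : set A^o :=
  if j is Posz i then @acomp F A i else [set 0].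

Lemma reg_sum : internal_direct_sum reg_comp.
Proof.
have [gA decA unA] := acomp_sum A; split => [[i|i]|x|s f us fA sf0].
- exact: gA.
- by split=> // x y -> ->; rewrite subr0.
- have [s [f [fA ->]]] := decA x.
  exists (map Posz s), (fun j => if j is Posz i then f i else 0).
  by split=> [[]//|]; rewrite big_map.
- pose t := pmap (fun j => if j is Posz i then Some i else None) s.
  have tE i : (i \in t) = (Posz i \in s).
    rewrite mem_pmap; apply/mapP/idP => [[[j|j]//= js [->]]//|si].
    by exists (Posz i).
  have ut : uniq t.
    apply: (pmap_uniq (g := Posz)) us.
    by case.
  have sE : \sum_(i <- t) f (Posz i) = 0.
    rewrite -[RHS]sf0 /t; elim: (s) => [|[j|j] r IH] /=; rewrite ?big_nil ?big_cons //.
      by rewrite IH.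
    by have := fA (Negz j) => /= ->; rewrite add0r IH.
  case=> [i|i] si; last exact: fA (Negz i).
  by apply: (unA t (fun i => f (Posz i)) ut _ sE) => [j|]; [exact: fA (Posz j)|rewrite tE].
Qed.

Lemma regZ i j a (x : A^o) :
  @acomp F A i a -> reg_comp j x -> reg_comp (i%:Z + j) (a *: x).
Proof.
case: j => [j|j] ai; first exact: acompM.
move=> /= ->; rewrite scaler0; case: (_ + _) => //= m.
by have [+ _ _] := acomp_sum A => /(_ m) [].
Qed.

Definition regmod : grmod := GrMod reg_sum regZ.
End Regular.

Section Top.
Variable M : grmod.

Definition JM : set M := smul_set radJ setT.

Lemma JM0 : JM 0.
Proof.
exists 0%N, (fun=> 0), (fun=> 0); split; first by case.
by rewrite big_ord0.
Qed.

Lemma JMD x y : JM x -> JM y -> JM (x + y).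
Proof.
move=> [n [a [m [am ->]]]] [n' [a' [m' [am' ->]]]].
exists (n + n')%N, (fun i => match split i with inl j => a j | inr j => a' j end),
  (fun i => match split i with inl j => m j | inr j => m' j end).
split=> [i|]; first by case: (split i).
rewrite big_split_ord /=; congr (_ + _); apply: eq_bigr => i _.
  by rewrite (unsplitK (inl i)).
by rewrite (unsplitK (inr i)).
Qed.

Lemma radJ_mull b a : radJ a -> radJ (b * a).
Proof.
have [gA decA _] := acomp_sum A.
have radD x y : radJ x -> radJ y -> radJ (x + y).
  move=> [n [f [fA ->]]] [m [g [gA' ->]]].
  exists (maxn n m), (fun i => (if (i < n)%N then f i else 0) + (if (i < m)%N then g i else 0)).
  split=> [i|].
    by have [g0 _] := gA i.+1; apply: additive_subgroupD (gA i.+1) _ _ _ _; case: ifP.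
  rewrite big_split /=; congr (_ + _).
    by rewrite (big_ord_widen _ f (leq_maxl n m)) big_mkcond.
  by rewrite (big_ord_widen _ g (leq_maxr n m)) big_mkcond.
have rad0 : radJ 0.
  exists 0%N, (fun=> 0); split; last by rewrite big_ord0.
  by move=> i; have [] := gA i.+1.
have rad1 i u : @acomp F A i.+1 u -> radJ u.
  move=> ui; exists i.+1, (fun j => if j == i then u else 0); split=> [j|].
    by case: eqP => [->//|_]; have [] := gA j.+1.
  rewrite big_ord_recr /= eqxx big1 ?add0r // => j _.
  by rewrite ltn_eqF.
move=> [n [f [fA ->]]]; have [s [g [gA' ->]]] := decA b.
rewrite big_distrl; elim/big_ind: _ => // i _.
rewrite big_distrr; elim/big_ind: _ => // j _.
by apply: (@rad1 (i + j)%N); rewrite -addnS; apply: acompM.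
Qed.

Lemma JMZ b x : JM x -> JM (b *: x).
Proof.
move=> [n [a [m [am ->]]]]; exists n, (fun i => b * a i), m; split=> [i|].
  by have [aJ _] := am i; split=> //; apply: radJ_mull.
by rewrite scaler_sumr; apply: eq_bigr => i _; rewrite scalerA.
Qed.

Lemma JMB x y : JM x -> JM y -> JM (x - y).
Proof. by move=> xJ yJ; apply: JMD => //; rewrite -scaleN1r; apply: JMZ. Qed.

Definition JMb : {pred M} := fun x => `[< JM x >].

Lemma JMb_zmod_closed : zmod_closed JMb.
Proof.
split=> [|x y]; first by apply/asboolP; exact: JM0.
by move=> /asboolP xJ /asboolP yJ; apply/asboolP; exact: JMB.
Qed.

HB.instance Definition _ := GRing.isZmodClosed.Build M JMb JMb_zmod_closed.

Definition top_sort : Type := Quotient.quot JMb.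

HB.instance Definition _ := GRing.Zmodule.on top_sort.

Definition top_pi (x : M) : top_sort := (\pi_(Quotient.quot JMb) x)%qT.
Definition top_repr (u : top_sort) : M := repr (u : Quotient.quot JMb).

Lemma top_reprK u : top_pi (top_repr u) = u.
Proof. exact: reprK. Qed.

Lemma top_piE x y : top_pi x = top_pi y <-> JM (x - y).
Proof.
split=> [/eqP|/asboolP H]; last first.
  by apply/eqP; rewrite /top_pi -Quotient.idealrBE.
by rewrite /top_pi -Quotient.idealrBE => /asboolP.
Qed.

Lemma top_piD x y : top_pi (x + y) = top_pi x + top_pi y.
Proof. exact: pi_addr. Qed.

Lemma top_pi0 : top_pi 0 = 0.
Proof. by apply: (addrI (top_pi 0)); rewrite -top_piD !addr0. Qed.

Lemma top_piN x : top_pi (- x) = - top_pi x.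
Proof. by apply: (addrI (top_pi x)); rewrite -top_piD !subrr top_pi0. Qed.

Definition top_scale (a : A) (u : top_sort) : top_sort := top_pi (a *: top_repr u).

Lemma top_scaleE a x : top_scale a (top_pi x) = top_pi (a *: x).
Proof.
apply/top_piE; rewrite -scalerBr; apply: JMZ.
by apply/top_piE; rewrite top_reprK.
Qed.

Lemma top_scalerA a b u : top_scale a (top_scale b u) = top_scale (a * b) u.
Proof. by rewrite -[u]top_reprK !top_scaleE scalerA. Qed.

Lemma top_scale1r : left_id 1 top_scale.
Proof. by move=> u; rewrite -[u]top_reprK top_scaleE scale1r. Qed.

Lemma top_scalerDr : right_distributive top_scale +%R.
Proof.
move=> a u v; rewrite -[u]top_reprK -[v]top_reprK -top_piD !top_scaleE.
by rewrite scalerDr top_piD.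
Qed.

Lemma top_scalerDl u : {morph top_scale^~ u : a b / a + b}.
Proof. by move=> a b; rewrite -[u]top_reprK !top_scaleE scalerDl top_piD. Qed.

HB.instance Definition _ := GRing.Zmodule_isLmodule.Build A top_sort
  top_scalerA top_scale1r top_scalerDr top_scalerDl.

Definition top_comp (j : int) : set top_sort := top_pi @` @mcomp M j.

Lemma top_pi_sum (I : Type) (s : seq I) (f : I -> M) :
  top_pi (\sum_(i <- s) f i) = \sum_(i <- s) top_pi (f i).
Proof. exact: (big_morph top_pi top_piD top_pi0). Qed.

Lemma JM_graded x : JM x -> exists (s : seq int) (g : int -> M),
  [/\ uniq s, forall j, @mcomp M j (g j) /\ JM (g j) & x = \sum_(j <- s) g j].
Proof.
have [gM decM _] := mcomp_sum M.
have gD j u v := additive_subgroupD (gM j) (x := u) (y := v).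
pose P (x : M) := exists (s : seq int) (g : int -> M),
  [/\ uniq s, forall j, @mcomp M j (g j) /\ JM (g j) & x = \sum_(j <- s) g j].
have P0 : P 0.
  exists [::], (fun=> 0); split=> // [j|]; last by rewrite big_nil.
  by split; [have [] := gM j | exact: JM0].
have widen (s t : seq int) (g : int -> M) : uniq s -> uniq t -> {subset s <= t} ->
    \sum_(j <- s) g j = \sum_(j <- t) (if j \in s then g j else 0).
  move=> us ut st; rewrite -big_mkcond -big_filter; apply: perm_big.
  apply: uniq_perm; rewrite ?filter_uniq // => j.
  by rewrite mem_filter; case: (boolP (j \in s)) => // /st ->.
have PD u v : P u -> P v -> P (u + v).
  move=> [s [g [us gP ->]]] [t [h [ut hP ->]]].
  exists (undup (s ++ t)), (fun j => (if j \in s then g j else 0) + (if j \in t then h j else 0)).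
  split; first exact: undup_uniq.
    move=> j; have [g0 _] := gM j; have [gj gJ] := gP j; have [hj hJ] := hP j.
    by split; [apply: gD | apply: JMD]; case: ifP => // _; exact: JM0.
  rewrite big_split /=; congr (_ + _); apply: widen; rewrite ?undup_uniq // => j;
    by rewrite mem_undup mem_cat => ->; rewrite ?orbT.
have P1 j u : @mcomp M j u -> JM u -> P u.
  move=> uj uJ; exists [:: j], (fun i => if i == j then u else 0).
  split=> // [i|]; last by rewrite big_seq1 eqxx.
  by case: eqP => [->//|_]; split; [have [] := gM i | exact: JM0].
have JMone i a m : @acomp F A i.+1 a -> JM (a *: m).
  move=> ai; exists 1%N, (fun=> a), (fun=> m); split; last by rewrite big_ord1.
  move=> _; split=> //; exists i.+1, (fun j => if j == i then a else 0); split=> [j|].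
    by case: eqP => [->//|_]; have [+ _ _] := acomp_sum A => /(_ j.+1) [].
  rewrite big_ord_recr /= eqxx big1 ?add0r // => k _.
  by rewrite ltn_eqF.
move=> [n [a [m [am ->]]]]; rewrite -/(P _); elim/big_ind: _ => // i _.
have [[l [f [fA ->]]] _] := am i; have [s [g [gMs ->]]] := decM (m i).
rewrite scaler_suml; elim/big_ind: _ => // k _.
rewrite scaler_sumr; elim/big_ind: _ => // j _.
by apply: (@P1 (k.+1%:Z + j)); [apply: mcompZ | apply: JMone (fA k)].
Qed.

Lemma top_sum : internal_direct_sum top_comp.
Proof.
have [gM decM unM] := mcomp_sum M.
split=> [i|u|s f us fT sf0].
- split; first by exists 0; [have [] := gM i | exact: top_pi0].
  move=> _ _ [x xi <-] [y yi <-]; exists (x - y); last by rewrite top_piD top_piN.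
  by have [_ gB] := gM i; apply: gB.
- have [s [f [fM xE]]] := decM (top_repr u).
  exists s, (top_pi \o f); split; first by move=> i; exists (f i).
  by rewrite -[u]top_reprK xE top_pi_sum.
- have /choice [g gP] j : exists x, @mcomp M j x /\ top_pi x = f j.
    by have [x xj xE] := fT j; exists x.
  have /JM_graded [t [h [ut hP hE]]] : JM (\sum_(j <- s) g j).
    rewrite -[X in JM X]subr0; apply/top_piE; rewrite top_pi_sum top_pi0 -[RHS]sf0.
    by apply: eq_bigr => j _; have [] := gP j.
  pose r := undup (s ++ t).
  pose e j := (if j \in s then g j else 0) - (if j \in t then h j else 0).
  have widen (s' : seq int) (k : int -> M) : uniq s' -> {subset s' <= r} ->
      \sum_(j <- s') k j = \sum_(j <- r) (if j \in s' then k j else 0).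
    move=> us' st; rewrite -big_mkcond -big_filter; apply: perm_big.
    apply: uniq_perm; rewrite ?filter_uniq ?undup_uniq // => j.
    by rewrite mem_filter; case: (boolP (j \in s')) => // /st ->.
  have e0 j : j \in r -> e j = 0.
    apply: unM (undup_uniq _) _ _ j => [j|].
      have [g0 gB] := gM j; have [gj _] := gP j; have [hj _] := hP j.
      by apply: gB; case: ifP.
    rewrite /e sumrB -!widen // ?hE ?subrr // => j;
      by rewrite mem_undup mem_cat => ->; rewrite ?orbT.
  move=> i si; have [_ <-] := gP i; rewrite -top_pi0; apply/top_piE; rewrite subr0.
  have /e0 : i \in r by rewrite mem_undup mem_cat si.
  rewrite /e si => /eqP; rewrite subr_eq0 => /eqP ->.
  by case: ifP => // _; [have [] := hP i | exact: JM0].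
Qed.

Lemma topZ i j a (u : top_sort) :
  @acomp F A i a -> top_comp j u -> top_comp (i%:Z + j) (a *: u).
Proof.
move=> ai [x xj <-]; exists (a *: x); first exact: mcompZ.
by rewrite -top_scaleE.
Qed.

Definition top : grmod := GrMod top_sum topZ.
End Top.

(* k = A / J, as JM regmod is J A = J. *)
Definition trivmod : grmod := top regmod.

Definition generated_in (M : grmod) (S : seq int) : Prop :=
  smul_set setT [set x : M | exists2 j, j \in S & mcomp j x] = setT.

Definition gr_projective (P : grmod) : Prop :=
  forall (X Y : grmod) (p : X -> Y) (f : P -> Y), gr_hom p -> gr_hom f ->
    (forall y, exists x, p x = y) ->
    exists2 g : P -> X, gr_hom g & forall x, p (g x) = f x.

Record grres (M : grmod) := GrRes {
  term :> nat -> grmod;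
  bd : forall n, term n.+1 -> term n;
  aug : term 0%N -> M;
  term_projective : forall n, gr_projective (term n);
  bd_hom : forall n, gr_hom (@bd n);
  aug_hom : gr_hom aug;
  aug_surj : forall y, exists x, aug x = y;
  exact_aug : forall x, aug x = 0 <-> exists y, @bd 0%N y = x;
  exact_bd : forall n x, @bd n x = 0 <-> exists y, @bd n.+1 y = x
}.

(* [syz Q i] is the kernel of the map out of Q_i, that is, the syzygy
   Omega^{i+1}(M) as a submodule of Q_i. *)
Definition syz (M : grmod) (Q : grres M) (i : nat) : set (Q i) :=
  match i return set (Q i) with
  | 0%N => [set x | aug x = 0]
  | j.+1 => [set x | bd x = 0]
  end.

Definition minimal (M : grmod) (Q : grres M) : Prop :=
  forall i, syz (i := i) `<=` smul_set radJ (setT : set (Q i)).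

(* Ext^n(M, N) computed by a graded projective resolution Q of M: the elements
   are the cohomology classes of \underline{Hom}_A(Q, N), as sets of cocycles. *)
Section Ext.
Variables (M : grmod) (Q : grres M) (N : grmod).

Definition cocycle (n : nat) (f : Q n -> N) : Prop :=
  uHom f /\ forall x, f (bd x) = 0.

Definition coboundary (n : nat) : (Q n -> N) -> Prop :=
  match n return (Q n -> N) -> Prop with
  | 0%N => fun f => forall x, f x = 0
  | m.+1 => fun f => exists2 g : Q m -> N, uHom g & forall x, f x = g (bd x)
  end.

Definition ext_class (n : nat) (f : Q n -> N) : set (Q n -> N) :=
  [set g | cocycle g /\ coboundary (fun x => g x - f x)].

Definition Ext (n : nat) : set (set (Q n -> N)) :=
  [set c | exists2 f : Q n -> N, cocycle f & c = ext_class f].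

Definition ext_add (n : nat) (a b : set (Q n -> N)) : set (Q n -> N) :=
  [set h | exists f g, [/\ a f, b g & forall x, h x = f x + g x]].

End Ext.

(* Yoneda product Ext^i(L, N) x Ext^n(M, L) -> Ext^{i+n}(M, N): a cocycle
   f : Q_n -> L is lifted to a chain map Q_{n+*} -> P_*. *)
Definition chain_lift (L M : grmod) (P : grres L) (Q : grres M) (n : nat)
    (f : Q n -> L) (phi : forall j, Q (j + n)%N -> P j) : Prop :=
  [/\ forall j, uHom (phi j),
      forall x, aug (phi 0%N x) = f x
    & forall j (x : Q (j.+1 + n)%N), bd (phi j.+1 x) = phi j (@bd M Q (j + n)%N x)].

Definition yoneda (L M N : grmod) (P : grres L) (Q : grres M) (i n : nat)
    (a : set (P i -> N)) (b : set (Q n -> L)) : set (Q (i + n)%N -> N) :=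
  [set h | exists g f phi,
    [/\ a g, b f, @chain_lift L M P Q n f phi
      & ext_class (fun x => g (phi i x)) h]].

(* E(A) = Ext(k, k) is computed by P and E(M) = Ext(M, k) by Q.  As E^0(M)
   consists of homogeneous elements, only graded submodules of E(M) matter. *)
Section Generation.
Variables (M : grmod) (P : grres trivmod) (Q : grres M).

Definition E_submodule (S : forall n, set (set (Q n -> trivmod))) : Prop :=
  [/\ forall n, S n `<=` @Ext M Q trivmod n,
      forall n, S n (ext_class (fun=> 0)),
      forall n a b, S n a -> S n b -> S n (ext_add a b)
    & forall i n a b, @Ext trivmod P trivmod i a -> S n b -> S (i + n)%N (yoneda a b)].

Definition E_generated_by_E0 : Prop :=
  forall S, E_submodule S -> @Ext M Q trivmod 0%N `<=` S 0%N ->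
    forall n, S n = @Ext M Q trivmod n.

End Generation.

Definition Delta (d n : nat) : seq int :=
  let m := (n %/ 3)%N in
  match (n %% 3)%N with
  | 0%N => [:: (2 * m * d)%N%:Z]
  | 1%N => [:: (2 * m * d + 1)%N%:Z]
  | _ => [:: (2 * m * d + d)%N%:Z; (2 * m * d + d + 1)%N%:Z]
  end.

Definition biKoszul (d : nat) (M : grmod) : Prop :=
  exists2 Q : grres M, minimal Q & forall n, generated_in (Q n) (Delta d n).

Definition biKoszul_algebra (d : nat) : Prop := biKoszul d trivmod.

Definition Gr0 (M : grmod) : Prop := generated_in M [:: 0].

(* The chain map phi lifts M -> M / JM, with phi 0 identifying the common
   projective cover Q_0 = R_0 of M and M / JM.  Omega^{i+1}(M) is read inside
   Omega^{i+1}(M / JM) as its image under phi i, with i + 1 = 3n + 2. *)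
Definition strongly_biKoszul (d : nat) (M : grmod) : Prop :=
  [/\ Gr0 M, biKoszul d M
    & exists (Q : grres M) (R : grres (top M)) (phi : forall j, Q j -> R j),
      [/\ minimal Q /\ minimal R,
          forall j, gr_hom (phi j),
          bijective (phi 0%N) /\ (forall x, aug (phi 0%N x) = top_pi (aug x)),
          forall j x, bd (phi j.+1 x) = phi j (bd x)
        & forall n, let i := (3 * n + 1)%N in
            smul_set radJ (phi i @` syz (i := i)) =
            smul_set radJ (syz (i := i)) `&` (phi i @` syz (i := i))]].

End Algebra.

(* Main.v *)
(* Since Q is minimal and J k = 0, all coboundaries with values in k vanish and
   E^n(M) = Hom_A(Q_n, k), where Q_n/JQ_n is detected by maps to k because A_0 is
   semisimple.

   (1) If E(M) = E(A) E^0(M), each f : Q_n -> k is a finite sum of maps h o phi_n with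
   phi : Q -> P a chain map of degree 0 and h : P_n -> k. Such maps vanish in the
   degrees outside Delta(n), as P_n is generated in Delta(n). Hence so is Q_n.

   (2) Let R be a minimal resolution of M/JM. It suffices that Q_n/JQ_n -> R_n/JR_n is
   injective: then f : Q_n -> k extends to R_n. As M/JM is semisimple of degree 0, R is,
   modulo J, a retract of a direct sum of copies of P, which writes f as a possibly
   infinite sum of maps h_t o alpha_t with h_t : P_n -> k of one degree. These h_t span a
   finite dimensional space, so the sum can be regrouped into a finite one.
   Injectivity goes by induction on n: a map of projectives that is injective modulo J is
   injective, because the intersection of the J^i Q_n is 0. If n is 0 or 1 modulo 3, the
   generators of Q_n lie in the lowest degree of R_n, where JR_n vanishes; if n is 2
   modulo 3, injectivity modulo J is the strong bi-Koszul condition. *)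

Require Import Defs.
From HB Require Import structures.
From mathcomp Require Import all_boot all_order all_algebra.
From mathcomp Require Import boolp classical_sets functions.

Set Implicit Arguments.
Unset Strict Implicit.
Unset Printing Implicit Defensive.

Import Order.TTheory GRing.Theory Num.Theory.
Local Open Scope classical_set_scope.
Local Open Scope ring_scope.

(** * Homogeneous components *)

(** Projectivity is only the lifting property against graded surjections and comes with no bound on
    degrees. That the terms of a minimal resolution vanish in low degrees is therefore proved, by
    comparing a projective with its truncations; these bounds start the inductions on degree behind
    Nakayama's lemma and local finiteness. The theorem fixes arbitrary minimal [P] and [Q], while
    the bi-Koszul and strong conditions assert only that some suitable resolutions exist; chain maps
    whose composite is the identity modulo J carry the conclusions over. In (2) [M] need not be
    finitely generated, so infinitely many copies of k may be needed. A map to k of degree m reads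
    only the degree m part of P_n, which is finite dimensional because A is generated by the finite
    dimensional A_0 and A_1. Writing the h_t over a finite subfamily, the coefficients move into the
    maps alpha_t, which remain chain maps because F is central in A. *)

Section LinearMaps.
Variables (R : pzRingType) (U V : lmodType R) (f : U -> V).
Hypothesis lf : linear f.

Lemma linD x y : f (x + y) = f x + f y.
Proof. by have := lf 1 x y; rewrite !scale1r. Qed.

Lemma lin0 : f 0 = 0.
Proof. by apply: (addrI (f 0)); rewrite -linD !addr0. Qed.

Lemma linZ a x : f (a *: x) = a *: f x.
Proof. by have := lf a x 0; rewrite lin0 !addr0. Qed.

Lemma linN x : f (- x) = - f x.
Proof. by rewrite -scaleN1r linZ scaleN1r. Qed.

Lemma linB x y : f (x - y) = f x - f y.
Proof. by rewrite linD linN. Qed.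

Lemma lin_sum (I : Type) (s : seq I) (P : pred I) (F : I -> U) :
  f (\sum_(i <- s | P i) F i) = \sum_(i <- s | P i) f (F i).
Proof. exact: (big_morph f linD lin0). Qed.

End LinearMaps.

Lemma linear_comp (R : pzRingType) (U V W : lmodType R) (f : V -> W) (g : U -> V) :
  linear f -> linear g -> linear (f \o g).
Proof. by move=> lf lg a x y /=; rewrite lg lf. Qed.

Lemma linear_sub (R : pzRingType) (U V : lmodType R) (f g : U -> V) :
  linear f -> linear g -> linear (fun x => f x - g x).
Proof.
by move=> lf lg a x y; rewrite lf lg scalerBr opprD addrACA.
Qed.

Section Components.
Variables (I : eqType) (V : zmodType) (G : I -> set V).
Hypothesis GS : internal_direct_sum G.

Lemma ids0 i : G i 0. Proof. by have [/(_ i)[]] := GS. Qed.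

Lemma idsB i x y : G i x -> G i y -> G i (x - y).
Proof. by have [/(_ i)[_ +] _ _] := GS; apply. Qed.

Lemma idsD i x y : G i x -> G i y -> G i (x + y).
Proof. by have [gi _ _] := GS; apply: additive_subgroupD. Qed.

Lemma ids_sum i (T : Type) (s : seq T) (P : pred T) (f : T -> V) :
  (forall t, P t -> G i (f t)) -> G i (\sum_(t <- s | P t) f t).
Proof. by move=> Gf; apply: big_ind => //; [exact: ids0 | exact: idsD]. Qed.

Lemma sum_widen (s t : seq I) (f : I -> V) : uniq s -> uniq t ->
  (forall i, i \notin s -> f i = 0) -> (forall i, i \notin t -> f i = 0) ->
  \sum_(i <- s) f i = \sum_(i <- t) f i.
Proof.
move=> us ut fs ft.
have E (u v : seq I) : uniq u -> uniq v -> (forall i, i \notin u -> f i = 0) ->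
    \sum_(i <- u) f i = \sum_(i <- undup (u ++ v)) f i.
  move=> uu uv fu; rewrite [RHS](bigID (mem u)) /= [X in _ + X]big1; last first.
    by move=> i /fu.
  rewrite addr0 -[RHS]big_filter; apply: perm_big; apply: uniq_perm => //.
    by rewrite filter_uniq ?undup_uniq.
  by move=> i; rewrite mem_filter mem_undup mem_cat; case: (i \in u).
rewrite (E s t) // (E t s) //; apply: perm_big; apply: uniq_perm; rewrite ?undup_uniq //.
by move=> i; rewrite !mem_undup !mem_cat orbC.
Qed.

Lemma ids_decomp x : exists c : I -> V, (forall i, G i (c i)) /\
  exists s, [/\ uniq s, forall i, i \notin s -> c i = 0 & x = \sum_(i <- s) c i].
Proof.
have [_ /(_ x)[s [f [Gf xE]]] _] := GS.
(* The given list [s] may repeat indices and [f] need not vanish outside it; weighting by the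
   multiplicity repairs both. *)
exists (fun i => f i *+ count_mem i s); split.
  by move=> i; elim: (count_mem i s) => [|n IH]; rewrite ?mulr0n ?mulrS;
    [exact: ids0 | exact: idsD].
exists (undup s); split; first exact: undup_uniq.
  by move=> i; rewrite mem_undup => /count_memPn ->; rewrite mulr0n.
by rewrite xE -big_undup_iterop_count.
Qed.

Definition hcomp (x : V) : I -> V := projT1 (cid (ids_decomp x)).

Lemma hcompP x i : G i (hcomp x i).
Proof. by have [h _] := projT2 (cid (ids_decomp x)). Qed.

Lemma hcomp_sum x : exists s, [/\ uniq s, forall i, i \notin s -> hcomp x i = 0
  & x = \sum_(i <- s) hcomp x i].
Proof. by have [_ h] := projT2 (cid (ids_decomp x)). Qed.

Lemma ids_inj (c : I -> V) s : uniq s -> (forall i, G i (c i)) ->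
  (forall i, i \notin s -> c i = 0) -> \sum_(i <- s) c i = 0 -> forall i, c i = 0.
Proof.
move=> us Gc c0 sE i; case: (boolP (i \in s)) => [|/c0//].
by have [_ _ h] := GS; apply: h.
Qed.

Lemma hcomp_uniq x (c : I -> V) s : uniq s -> (forall i, G i (c i)) ->
  (forall i, i \notin s -> c i = 0) -> x = \sum_(i <- s) c i -> forall i, hcomp x i = c i.
Proof.
move=> us Gc cs xE i; have [t [ut ht hE]] := hcomp_sum x.
pose r := undup (s ++ t).
apply/eqP; rewrite -subr_eq0; apply/eqP.
apply: (@ids_inj (fun i => hcomp x i - c i) r) => [|j|j|].
- exact: undup_uniq.
- by apply: idsB => //; exact: hcompP.
- by rewrite mem_undup mem_cat negb_or => /andP[/cs -> /ht ->]; rewrite subr0.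
have rs j : j \notin r -> c j = 0.
  by rewrite mem_undup mem_cat negb_or => /andP[/cs -> _].
have rt j : j \notin r -> hcomp x j = 0.
  by rewrite mem_undup mem_cat negb_or => /andP[_ /ht ->].
by rewrite sumrB -(sum_widen ut (undup_uniq _) ht rt) -hE
  -(sum_widen us (undup_uniq _) cs rs) -xE subrr.
Qed.

Lemma hcompD x y i : hcomp (x + y) i = hcomp x i + hcomp y i.
Proof.
have [s [us hs xE]] := hcomp_sum x; have [t [ut ht yE]] := hcomp_sum y.
pose r := undup (s ++ t).
have rs j : j \notin r -> hcomp x j = 0.
  by rewrite mem_undup mem_cat negb_or => /andP[/hs -> _].
have rt j : j \notin r -> hcomp y j = 0.
  by rewrite mem_undup mem_cat negb_or => /andP[_ /ht ->].
apply: (@hcomp_uniq _ (fun i => hcomp x i + hcomp y i) r) => [|j|j h|].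
- exact: undup_uniq.
- by apply: idsD; exact: hcompP.
- by rewrite rs // rt // addr0.
rewrite big_split /= {1}xE {1}yE (sum_widen us (undup_uniq (s ++ t)) hs rs).
by rewrite (sum_widen ut (undup_uniq (s ++ t)) ht rt).
Qed.

Lemma hcomp_hom i x : G i x -> forall j, hcomp x j = if j == i then x else 0.
Proof.
move=> xi; apply: (@hcomp_uniq _ _ [:: i]) => [//|j|j|].
- by case: eqP => [->//|_]; exact: ids0.
- by rewrite inE => /negbTE ->.
by rewrite big_seq1 eqxx.
Qed.

Lemma hcomp0 i : hcomp 0 i = 0.
Proof. by rewrite (hcomp_hom (ids0 i)) if_same. Qed.

Lemma hcompN x i : hcomp (- x) i = - hcomp x i.
Proof. by apply: (addrI (hcomp x i)); rewrite -hcompD !subrr hcomp0. Qed.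

Lemma hcompB x y i : hcomp (x - y) i = hcomp x i - hcomp y i.
Proof. by rewrite hcompD hcompN. Qed.

Lemma hcomp_bigsum (T : Type) (s : seq T) (P : pred T) (f : T -> V) i :
  hcomp (\sum_(t <- s | P t) f t) i = \sum_(t <- s | P t) hcomp (f t) i.
Proof. by apply: (big_morph (hcomp^~ i)) => [x y|]; rewrite ?hcompD ?hcomp0. Qed.

Lemma hcomp_eq0 x : (forall i, hcomp x i = 0) -> x = 0.
Proof. by move=> h; have [s [_ _ ->]] := hcomp_sum x; rewrite big1. Qed.

End Components.

(** * Homogeneous parts of graded modules and the submodule JM *)

Section GradedModules.
Variables (F : fieldType) (A : gralg F).
Implicit Types (M N : grmod A).

Definition gproj M (j : int) (x : M) : M := hcomp (mcomp_sum M) x j.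

Lemma gprojP M j (x : M) : mcomp j (gproj j x). Proof. exact: hcompP. Qed.

Lemma gproj_sum M (x : M) : exists s, [/\ uniq s, forall i, i \notin s -> gproj i x = 0
  & x = \sum_(i <- s) gproj i x].
Proof. exact: hcomp_sum. Qed.

Lemma gprojD M j (x y : M) : gproj j (x + y) = gproj j x + gproj j y.
Proof. exact: hcompD. Qed.

Lemma gprojB M j (x y : M) : gproj j (x - y) = gproj j x - gproj j y.
Proof. exact: hcompB. Qed.

Lemma gproj0 M j : gproj j (0 : M) = 0. Proof. exact: hcomp0. Qed.

Lemma gproj_hom M i j (x : M) : mcomp i x -> gproj j x = if j == i then x else 0.
Proof. by move=> xi; apply: hcomp_hom. Qed.

Lemma gproj_id M i (x : M) : mcomp i x -> gproj i x = x.
Proof. by move/gproj_hom ->; rewrite eqxx. Qed.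

Lemma gproj_bigsum M j (T : Type) (s : seq T) (P : pred T) (f : T -> M) :
  gproj j (\sum_(t <- s | P t) f t) = \sum_(t <- s | P t) gproj j (f t).
Proof. exact: hcomp_bigsum. Qed.

Lemma gproj_eq0 M (x : M) : (forall i, gproj i x = 0) -> x = 0.
Proof. exact: hcomp_eq0. Qed.

Lemma gproj_eq M (x y : M) : (forall i, gproj i x = gproj i y) -> x = y.
Proof.
move=> h; apply/eqP; rewrite -subr_eq0; apply/eqP/gproj_eq0 => i.
by rewrite gprojB h subrr.
Qed.

Lemma mcomp0 M j : mcomp j (0 : M). Proof. exact: (ids0 (mcomp_sum M)). Qed.

Lemma mcompD M j (x y : M) : mcomp j x -> mcomp j y -> mcomp j (x + y).
Proof. exact: (idsD (mcomp_sum M)). Qed.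

Lemma mcompB M j (x y : M) : mcomp j x -> mcomp j y -> mcomp j (x - y).
Proof. exact: (idsB (mcomp_sum M)). Qed.

Lemma mcomp_bigsum M j (T : Type) (s : seq T) (P : pred T) (f : T -> M) :
  (forall t, P t -> mcomp j (f t)) -> mcomp j (\sum_(t <- s | P t) f t).
Proof. exact: (ids_sum (mcomp_sum M)). Qed.

Lemma regcompZ M i j (a : regmod A) (x : M) :
  mcomp i a -> mcomp j x -> mcomp (i + j) ((a : A) *: x).
Proof.
case: i => i ai xj; first exact: mcompZ.
by rewrite ai scale0r; apply: mcomp0.
Qed.

(** The scalar is read in [regmod], whose degrees are integers, because [j - s] may be negative. *)
Lemma gproj_scale M s j (a : A) (x : M) : mcomp s x ->
  gproj j (a *: x) = (gproj (j - s) (a : regmod A) : A) *: x.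
Proof.
move=> xs; have [t [ut t0 aE]] := gproj_sum (a : regmod A).
rewrite {1}aE scaler_suml gproj_bigsum.
have E i : gproj j ((gproj i (a : regmod A) : A) *: x) =
    if i == j - s then (gproj i (a : regmod A) : A) *: x else 0.
  rewrite (gproj_hom _ (regcompZ (gprojP i _) xs)).
  by rewrite -subr_eq eq_sym.
under eq_bigr do rewrite E.
case: (boolP (j - s \in t)) => h.
  rewrite (bigD1_seq (j - s) h ut) /= eqxx big1 ?addr0 // => i /negbTE -> //.
rewrite (t0 _ h) scale0r big_seq big1 // => i it; case: eqP => // e.
by rewrite -e it in h.
Qed.

Lemma gr_hom_proj M N (f : M -> N) j x : gr_hom f -> f (gproj j x) = gproj j (f x).
Proof.
move=> [lf hf]; have [s [us s0 xE]] := gproj_sum x.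
rewrite [in RHS]xE (lin_sum lf) gproj_bigsum.
under eq_bigr do rewrite (gproj_hom _ (hf _ _ (gprojP _ _))).
case: (boolP (j \in s)) => h.
  rewrite (bigD1_seq j h us) /= eqxx big1 ?addr0 // => i.
  by rewrite eq_sym => /negbTE ->.
rewrite (s0 _ h) (lin0 lf) big_seq big1 // => i si; case: eqP => // e.
by rewrite e si in h.
Qed.

Lemma gr_hom_id M : gr_hom (@id M). Proof. by []. Qed.

Lemma gr_hom_comp (L M N : grmod A) (f : M -> N) (g : L -> M) :
  gr_hom f -> gr_hom g -> gr_hom (f \o g).
Proof.
move=> [lf hf] [lg hg]; split; first exact: linear_comp.
by move=> j x xj; apply/hf/hg.
Qed.

Lemma gr_hom_sub M N (f g : M -> N) :
  gr_hom f -> gr_hom g -> gr_hom (fun x => f x - g x).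
Proof.
move=> [lf hf] [lg hg]; split; first exact: linear_sub.
by move=> j x xj; apply: mcompB; [exact: hf | exact: hg].
Qed.

Lemma smul_set0 (M : lmodType A) (I : set A) (X : set M) : smul_set I X 0.
Proof.
by exists 0%N, (fun=> 0), (fun=> 0); split; [case | rewrite big_ord0].
Qed.

Lemma smul_setD (M : lmodType A) (I : set A) (X : set M) x y :
  smul_set I X x -> smul_set I X y -> smul_set I X (x + y).
Proof.
move=> [n [a [m [am ->]]]] [n' [a' [m' [am' ->]]]].
exists (n + n')%N, (fun i => match fintype.split i with inl j => a j | inr j => a' j end),
  (fun i => match fintype.split i with inl j => m j | inr j => m' j end).
split=> [i|]; first by case: (fintype.split i).
rewrite big_split_ord /=; congr (_ + _); apply: eq_bigr => i _.
  by rewrite (unsplitK (inl i)).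
by rewrite (unsplitK (inr i)).
Qed.

Lemma smul_set1 (M : lmodType A) (I : set A) (X : set M) a x :
  I a -> X x -> smul_set I X (a *: x).
Proof. by move=> Ia Xx; exists 1%N, (fun=> a), (fun=> x); rewrite big_ord1. Qed.

Lemma smul_set_ind (M : lmodType A) (I : set A) (X : set M) (S : M -> Prop) :
  S 0 -> (forall x y, S x -> S y -> S (x + y)) -> (forall a x, I a -> X x -> S (a *: x)) ->
  smul_set I X `<=` S.
Proof.
move=> S0 SD SZ _ [n [a [m [am ->]]]]; apply: big_ind => // i _.
by have [Ia Xm] := am i; apply: SZ.
Qed.

Lemma smul_setZ (M : lmodType A) (I : set A) (X : set M) b x :
  (forall a, I a -> I (b * a)) -> smul_set I X x -> smul_set I X (b *: x).
Proof.
move=> Ib [n [a [m [am ->]]]]; exists n, (fun i => b * a i), m; split=> [i|].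
  by have [/Ib] := am i.
by rewrite scaler_sumr; apply: eq_bigr => i _; rewrite scalerA.
Qed.

Lemma JM_sum M (T : Type) (s : seq T) (P : pred T) (f : T -> M) :
  (forall t, P t -> JM (f t)) -> JM (\sum_(t <- s | P t) f t).
Proof. by move=> h; apply: big_ind => //; [exact: JM0 | exact: JMD]. Qed.

Lemma JM_hom M N (f : M -> N) x : linear f -> JM x -> JM (f x).
Proof.
move=> lf [n [a [m [am ->]]]]; rewrite (lin_sum lf).
exists n, a, (f \o m); split=> [i|]; first by have [] := am i.
by apply: eq_bigr => i _; rewrite (linZ lf).
Qed.

Lemma acomp_radJ i (a : A) : acomp i.+1 a -> radJ a.
Proof.
move=> ai; exists i.+1, (fun j => if j == i then a else 0); split=> [j|].
  by case: eqP => [->//|_]; exact: (ids0 (acomp_sum A)).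
rewrite big_ord_recr /= eqxx big1 ?add0r // => j _.
by rewrite ltn_eqF.
Qed.

Lemma JM_scale M (a : A) (x : M) : radJ a -> JM (a *: x).
Proof. by move=> aJ; exists 1%N, (fun=> a), (fun=> x); rewrite big_ord1. Qed.

(** Expanding scalars and vectors into homogeneous parts leaves only terms whose vector has degree
    strictly below [j]; this is what makes induction on the degree possible. *)
Lemma JM_hom_ind M (j : int) (S : M -> Prop) : S 0 -> (forall u v, S u -> S v -> S (u + v)) ->
  (forall i (a : A) m, acomp i.+1 a -> mcomp (j - i.+1%:Z) m -> S (a *: m)) ->
  forall x, JM x -> S (gproj j x).
Proof.
move=> S0 SD S1 x [n [a [m [am ->]]]].
rewrite gproj_bigsum; apply: big_ind => // k _; have [[l [f [fA ->]]] _] := am k.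
rewrite scaler_suml gproj_bigsum; apply: big_ind => // i _.
have [s [us _ ->]] := gproj_sum (m k).
rewrite scaler_sumr gproj_bigsum; apply: big_ind => // h _.
rewrite (gproj_hom _ (mcompZ (fA i) (gprojP h _))).
case: eqP => // jE; apply: S1 (fA i) _.
by rewrite jE addrAC subrr add0r; apply: gprojP.
Qed.

Lemma JM_proj M j (x : M) : JM x -> JM (gproj j x).
Proof.
apply: JM_hom_ind => [||i a m /acomp_radJ ai _]; [exact: JM0|exact: JMD|exact: JM_scale].
Qed.

Lemma gen_hom_ind M S j (X : M -> Prop) : generated_in M S ->
  X 0 -> (forall u v, X u -> X v -> X (u + v)) ->
  (forall i s (a : A) m, s \in S -> acomp i a -> mcomp s m -> j = i%:Z + s -> X (a *: m)) ->
  forall x, mcomp j x -> X x.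
Proof.
move=> gS X0 XD X1 x xj; have : setT x by [].
rewrite -gS => -[n [a [m [am xE]]]].
rewrite -(gproj_id xj) xE gproj_bigsum; apply: big_ind => // k _.
have [_ [s sS ms]] := am k; rewrite (gproj_scale _ _ ms).
move: (gprojP (j - s) (a k : regmod A)).
case E : (j - s) => [i|i] h; last by rewrite h scale0r.
by apply: X1 sS h ms _; rewrite -E subrK.
Qed.

(** A coefficient of degree 0 would put [j] in [S], so all coefficients have positive degree. *)
Lemma gen_JM M S j (x : M) : generated_in M S -> j \notin S -> mcomp j x -> JM x.
Proof.
move=> gS jS; apply: (gen_hom_ind gS) => [||[|i] s a m sS ai ms jE].
- exact: JM0.
- exact: JMD.
- by rewrite jE add0r sS in jS.
- exact/JM_scale/acomp_radJ/ai.
Qed.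

Definition below M (l : int) := forall j (x : M), j < l -> mcomp j x -> x = 0.

Lemma gen_below M S l : generated_in M S -> (forall s, s \in S -> l <= s) -> below M l.
Proof.
move=> gS Sl j x jl; apply: (gen_hom_ind (X := fun y => y = 0) gS) => [//|u v -> ->|i s a m sS _ _ jE].
  by rewrite addr0.
have := le_lt_trans (Sl s sS) (le_lt_trans _ jl).
by rewrite jE lerDr ltxx => /(_ isT).
Qed.

Lemma below_ind M l (X : M -> Prop) : below M l -> X 0 ->
  (forall j, (forall i x, i < j -> mcomp i x -> X x) -> forall x, mcomp j x -> X x) ->
  forall j x, mcomp j x -> X x.
Proof.
move=> bM X0 step j; have [n jn] : exists n : nat, j < l + n%:Z.
  exists `|j - l|%N.+1; rewrite -ltrBlDl; apply: le_lt_trans (ler_norm _) _.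
  by rewrite -abszE ltz_nat.
elim: n j jn => [|n IH] j jn x xj; first by rewrite (bM _ _ _ xj) // -[l]addr0.
apply: (step j) xj => i y ij; apply: IH; apply: lt_le_trans ij _.
by move: jn; rewrite intS [1 + _]addrC addrA ltzD1.
Qed.

Definition geq_deg M (l : int) : set M := [set x | forall j, j < l -> gproj j x = 0].

End GradedModules.

(** * Graded submodules and direct sums *)

Section Submodules.
Variables (F : fieldType) (A : gralg F).

Record gsubmod (M : grmod A) := GSubmod {
  gs_set :> M -> Prop;
  gs_add : forall x y, gs_set x -> gs_set y -> gs_set (x + y);
  gs_scale : forall (a : A) x, gs_set x -> gs_set (a *: x);
  gs_zero : gs_set 0;
  gs_proj : forall j x, gs_set x -> gs_set (gproj j x)
}.

Section Submodule.
Variables (M : grmod A) (S : gsubmod M).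

Definition gs_pred : {pred M} := fun x => `[< S x >].

Lemma gs_submod_closed : submod_closed gs_pred.
Proof.
split=> [|a x y /asboolP Sx /asboolP Sy]; apply/asboolP; first exact: gs_zero.
by apply: gs_add => //; apply: gs_scale.
Qed.

HB.instance Definition _ := GRing.isSubmodClosed.Build A M gs_pred gs_submod_closed.

Record gs_sort : Type := GsSub { gs_val : M; _ : gs_val \in gs_pred }.

HB.instance Definition _ := [isSub for gs_val].
HB.instance Definition _ := [Choice of gs_sort by <:].
HB.instance Definition _ := [SubChoice_isSubLmodule of gs_sort by <:].

Lemma gs_valP (x : gs_sort) : S (gs_val x).
Proof. by case: x => x /= /asboolP. Qed.

Definition gs_of x (Sx : S x) : gs_sort := GsSub (introT (asboolP (S x)) Sx).

Lemma gs_val_inj : injective gs_val. Proof. exact: val_inj. Qed.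

Lemma gs_val_linear : linear gs_val.
Proof. by move=> a x y; rewrite GRing.valD GRing.valZ. Qed.

Definition gs_comp (j : int) : set gs_sort := [set x | mcomp j (gs_val x)].

Lemma gs_val_sum (I : Type) (s : seq I) (f : I -> gs_sort) :
  gs_val (\sum_(i <- s) f i) = \sum_(i <- s) gs_val (f i).
Proof. exact: lin_sum gs_val_linear _ _ _ _. Qed.

Lemma gs_sum : internal_direct_sum gs_comp.
Proof.
split=> [j|x|s f us fj s0 i si].
- split=> [|x y xj yj]; rewrite /gs_comp /mkset ?(lin0 gs_val_linear); first exact: mcomp0.
  by rewrite (linB gs_val_linear); apply: mcompB.
- have [s [_ _ xE]] := gproj_sum (gs_val x).
  exists s, (fun j => gs_of (gs_proj j (gs_valP x))); split=> [j|]; first exact: gprojP.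
  by apply: gs_val_inj; rewrite gs_val_sum.
- apply: gs_val_inj; rewrite (lin0 gs_val_linear).
  have [_ _ h] := mcomp_sum M; apply: (h s (gs_val \o f)) => //.
  by rewrite -gs_val_sum s0 (lin0 gs_val_linear).
Qed.

Lemma gs_compZ i j a x : acomp i a -> gs_comp j x -> gs_comp (i%:Z + j) (a *: x).
Proof. by move=> ai xj; rewrite /gs_comp /mkset (linZ gs_val_linear); apply: mcompZ. Qed.

Definition gsmod : grmod A := GrMod gs_sum gs_compZ.

Lemma gs_val_hom : @gr_hom F A gsmod M gs_val.
Proof. by split; [exact: gs_val_linear | ]. Qed.

Section Corestriction.
Variables (N : grmod A) (f : N -> M).
Hypotheses (fhom : gr_hom f) (fS : forall x, S (f x)).

Definition gs_lift (x : N) : gsmod := gs_of (fS x).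

Lemma gs_lift_hom : gr_hom gs_lift.
Proof.
have [lf hf] := fhom; split=> [a x y|j x xj]; last exact: hf.
by apply: gs_val_inj; rewrite gs_val_linear; exact: lf.
Qed.
End Corestriction.
End Submodule.

Lemma gr_hom_im (M N : grmod A) (f : M -> N) : gr_hom f -> exists S : gsubmod N,
  forall y, S y <-> exists x, f x = y.
Proof.
move=> hf; have [lf hf'] := hf.
have h1 x y : (exists z, f z = x) -> (exists z, f z = y) -> exists z, f z = x + y.
  by move=> [u <-] [v <-]; exists (u + v); rewrite (linD lf).
have h2 (a : A) x : (exists z, f z = x) -> exists z, f z = a *: x.
  by move=> [u <-]; exists (a *: u); rewrite (linZ lf).
have h3 : exists z, f z = 0 by exists 0; rewrite (lin0 lf).
have h4 j x : (exists z, f z = x) -> exists z, f z = gproj j x.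
  by move=> [u <-]; exists (gproj j u); rewrite (gr_hom_proj _ _ hf).
by exists (@GSubmod N [set y | exists x, f x = y] h1 h2 h3 h4).
Qed.

(** Projectivity speaks of surjections only; [Y] is replaced by the image of [p], which is again a
    graded module. *)
Lemma gr_lift (Q X Y : grmod A) (p : X -> Y) (f : Q -> Y) :
  gr_projective Q -> gr_hom p -> gr_hom f -> (forall x, exists y, p y = f x) ->
  exists2 g : Q -> X, gr_hom g & forall x, p (g x) = f x.
Proof.
move=> pQ hp hf fp; have [S SP] := gr_hom_im hp.
have pS x : S (p x) by apply/SP; exists x.
have fS x : S (f x) by apply/SP.
have [||y|g hg gE] := pQ _ _ (gs_lift pS) (gs_lift fS).
- exact: gs_lift_hom.
- exact: gs_lift_hom.
- have /SP [x xE] := gs_valP y; exists x; apply: gs_val_inj; exact: xE.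
by exists g => // x; have := congr1 (@gs_val _ _) (gE x).
Qed.

End Submodules.

Section DirectSums.
Variables (F : fieldType) (A : gralg F) (I : choiceType).

Section DirectSum.
Variable V : grmod A.

Definition fsupp : {pred I -> V} :=
  fun f => `[< exists s : seq I, forall i, i \notin s -> f i = 0 >].

Lemma fsupp_closed : submod_closed fsupp.
Proof.
split=> [|a f g /asboolP [s hs] /asboolP [t ht]]; apply/asboolP; first by exists [::].
exists (s ++ t) => i; rewrite mem_cat negb_or => /andP[/hs f0 /ht g0].
by rewrite !fctE f0 g0 scaler0 addr0.
Qed.

HB.instance Definition _ := GRing.isSubmodClosed.Build A (I -> V) fsupp fsupp_closed.

Record dsum_sort : Type := DSum { dsum_fun : I -> V; _ : dsum_fun \in fsupp }.

HB.instance Definition _ := [isSub for dsum_fun].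
HB.instance Definition _ := [Choice of dsum_sort by <:].
HB.instance Definition _ := [SubChoice_isSubLmodule of dsum_sort by <:].

Lemma dsumP (x : dsum_sort) : exists s : seq I, forall i, i \notin s -> dsum_fun x i = 0.
Proof. by case: x => x /= /asboolP. Qed.

Definition dsum_of (f : I -> V) (fs : exists s : seq I, forall i, i \notin s -> f i = 0) :=
  DSum (introT (asboolP _) fs).

Lemma dsum_ext (x y : dsum_sort) : (forall i, dsum_fun x i = dsum_fun y i) -> x = y.
Proof. by move=> h; apply/val_inj/funext. Qed.

Lemma dsum_fun_linear i : linear (fun x => dsum_fun x i).
Proof.
by move=> a x y; rewrite GRing.valD GRing.valZ.
Qed.

Lemma dsum_fun_sum (J : Type) (s : seq J) (f : J -> dsum_sort) i :
  dsum_fun (\sum_(j <- s) f j) i = \sum_(j <- s) dsum_fun (f j) i.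
Proof. exact: lin_sum (dsum_fun_linear i) _ _ _ _. Qed.

Definition dsum_comp (j : int) : set dsum_sort := [set x | forall i, mcomp j (dsum_fun x i)].

Lemma dsum_sum : internal_direct_sum dsum_comp.
Proof.
split=> [j|x|s f us fj s0 j js].
- split=> [i|x y xj yj i]; first by rewrite (lin0 (dsum_fun_linear i)); exact: mcomp0.
  by rewrite (linB (dsum_fun_linear i)); apply: mcompB.
- have [s hs] := dsumP x.
  have ex j : exists s : seq I, forall i, i \notin s -> gproj j (dsum_fun x i) = 0.
    by exists s => i /hs ->; rewrite gproj0.
  have [t tP] : exists t, [/\ uniq t & forall j, j \notin t -> forall i, i \in s ->
      gproj j (dsum_fun x i) = 0].
    elim: (s) => [|i r [t [ut tP]]]; first by exists [::].
    have [t' [ut' t'P _]] := gproj_sum (dsum_fun x i).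
    exists (undup (t ++ t')); split; first exact: undup_uniq.
    move=> j; rewrite mem_undup mem_cat negb_or => /andP[jt jt'] k.
    by rewrite inE => /predU1P[->|]; [exact: t'P | exact: tP].
  have [ut {}tP] := tP.
  exists t, (fun j => dsum_of (ex j)); split=> [j i|]; first exact: gprojP.
  apply: dsum_ext => i; rewrite dsum_fun_sum /=.
  have [is_|/hs ->] := boolP (i \in s); last by rewrite big1 // => j _; rewrite gproj0.
  have [t' [ut' t'P {1}->]] := gproj_sum (dsum_fun x i).
  by apply: sum_widen => // j /tP; apply.
- apply: dsum_ext => i; rewrite (lin0 (dsum_fun_linear i)).
  have [_ _ h] := mcomp_sum V; apply: (h s (fun j => dsum_fun (f j) i)) => //.
    by move=> k; apply: fj.
  by rewrite -dsum_fun_sum s0 (lin0 (dsum_fun_linear i)).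
Qed.

Lemma dsum_compZ i j a x : acomp i a -> dsum_comp j x -> dsum_comp (i%:Z + j) (a *: x).
Proof. by move=> ai xj k; rewrite (linZ (dsum_fun_linear k)); apply: mcompZ. Qed.

Definition dsum : grmod A := GrMod dsum_sum dsum_compZ.

Definition dproj (i : I) (x : dsum) : V := dsum_fun x i.

Lemma dproj_hom i : gr_hom (dproj i).
Proof. by split=> [|j x]; [exact: dsum_fun_linear | apply]. Qed.

Lemma dsum_eq (x y : dsum) : (forall i, dproj i x = dproj i y) -> x = y.
Proof. exact: dsum_ext. Qed.

Lemma dproj_supp (x : dsum) : exists s, uniq s /\ forall i, i \notin s -> dproj i x = 0.
Proof.
have [s hs] := dsumP x; exists (undup s); rewrite undup_uniq; split=> // i.
by rewrite mem_undup; apply: hs.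
Qed.

Lemma dsum_mk (f : I -> V) (s : seq I) : (forall i, i \notin s -> f i = 0) ->
  exists x : dsum, forall i, dproj i x = f i.
Proof.
move=> fs; have h : exists s : seq I, forall i, i \notin s -> f i = 0 by exists s.
by exists (dsum_of h).
Qed.

Definition dsupp (x : dsum) : seq I := projT1 (cid (dproj_supp x)).

Lemma dsuppP (x : dsum) : uniq (dsupp x) /\ forall i, i \notin dsupp x -> dproj i x = 0.
Proof. exact: projT2 (cid (dproj_supp x)). Qed.

Section Total.
Variables (N : grmod A) (g : I -> V -> N).
Hypothesis hg : forall i, gr_hom (g i).

(** The map out of the direct sum given by its universal property. *)
Definition dtotal (x : dsum) : N := \sum_(i <- dsupp x) g i (dproj i x).

Lemma dtotalE x s : uniq s -> (forall i, i \notin s -> dproj i x = 0) ->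
  dtotal x = \sum_(i <- s) g i (dproj i x).
Proof.
have [ux hx] := dsuppP x; move=> us hs; apply: sum_widen => // i.
  by move/hx->; rewrite (lin0 (hg i).1).
by move/hs->; rewrite (lin0 (hg i).1).
Qed.

Lemma dtotal_hom : gr_hom dtotal.
Proof.
split=> [a x y|j x xj]; last first.
  by apply: mcomp_bigsum => i _; apply: (hg i).2; apply: (dproj_hom i).2.
have [ux hx] := dsuppP x; have [uy hy] := dsuppP y.
pose s := undup (dsupp x ++ dsupp y).
have us : uniq s by exact: undup_uniq.
have sx i : i \notin s -> dproj i x = 0.
  by rewrite mem_undup mem_cat negb_or => /andP[/hx].
have sy i : i \notin s -> dproj i y = 0.
  by rewrite mem_undup mem_cat negb_or => /andP[_ /hy].
have sxy i : i \notin s -> dproj i (a *: x + y) = 0.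
  by move=> h; rewrite (dproj_hom i).1 sx // sy // scaler0 addr0.
rewrite (dtotalE us sx) (dtotalE us sy) (dtotalE us sxy) scaler_sumr -big_split.
by apply: eq_bigr => i _; rewrite (dproj_hom i).1 (hg i).1.
Qed.

Lemma dtotal_one x i : (forall k, k != i -> dproj k x = 0) -> dtotal x = g i (dproj i x).
Proof.
move=> h; rewrite (@dtotalE _ [:: i]) ?big_seq1 // => k.
by rewrite inE; apply: h.
Qed.

End Total.

Lemma dinj_ex : exists e : I -> V -> dsum, forall i,
  [/\ gr_hom (e i), forall x, dproj i (e i x) = x & forall x k, k != i -> dproj k (e i x) = 0].
Proof.
have /choice [e eP] (i : I) : exists e : V -> dsum,
    [/\ gr_hom e, forall x, dproj i (e x) = x & forall x k, k != i -> dproj k (e x) = 0].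
  have /choice [e eP] x : exists y, forall k, dproj k y = if k == i then x else 0.
    apply: (@dsum_mk (fun k => if k == i then x else 0) [:: i]) => k.
    by rewrite inE => /negbTE ->.
  exists e; split=> [|x|x k /negbTE ki]; [|by rewrite eP eqxx|by rewrite eP ki].
  split=> [a x y|j x xj k].
    apply: dsum_eq => k; rewrite (dproj_hom k).1 !eP; case: ifP => // _.
    by rewrite scaler0 addr0.
  by have := eP x k; rewrite /dproj => ->; case: eqP => // _; exact: mcomp0.
by exists e.
Qed.

Definition dinj : I -> V -> dsum := projT1 (cid dinj_ex).

Lemma dinj_hom i : gr_hom (dinj i).
Proof. by have [] := projT2 (cid dinj_ex) i. Qed.

Lemma dprojK i x : dproj i (dinj i x) = x.
Proof. by have [] := projT2 (cid dinj_ex) i. Qed.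

Lemma dproj_neq i k x : k != i -> dproj k (dinj i x) = 0.
Proof. by have [_ _] := projT2 (cid dinj_ex) i; apply. Qed.

Lemma dsum_decomp (x : dsum) : x = \sum_(i <- dsupp x) dinj i (dproj i x).
Proof.
have [ux hx] := dsuppP x.
apply: dsum_eq => k; rewrite (lin_sum (dproj_hom k).1).
have [ks|ks] := boolP (k \in dsupp x).
  rewrite (bigD1_seq k ks ux) /= dprojK big1 ?addr0 // => i ik.
  by rewrite dproj_neq // eq_sym.
rewrite hx // big_seq big1 // => i is_; rewrite dproj_neq //.
by apply: contraNneq ks => ->.
Qed.

Lemma dsum_projective : gr_projective V -> gr_projective dsum.
Proof.
move=> pV X Y p f hp hf ps.
have /choice [g gP] i : exists g : V -> X, gr_hom g /\ forall x, p (g x) = f (dinj i x).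
  have [g hg gE] := pV X Y p (f \o dinj i) hp (gr_hom_comp hf (dinj_hom i)) ps.
  by exists g.
have hg i : gr_hom (g i) by have [] := gP i.
exists (dtotal g); first exact: dtotal_hom.
move=> x; rewrite /dtotal (lin_sum hp.1) [in RHS](dsum_decomp x) (lin_sum hf.1).
by apply: eq_bigr => i _; have [_ ->] := gP i.
Qed.

End DirectSum.

Section Map.
Variables (V W : grmod A) (f : V -> W).
Hypothesis hf : gr_hom f.

Definition dmap : dsum V -> dsum W := dtotal (fun i x => dinj i (f x)).

Lemma dmap_hom : gr_hom dmap.
Proof. by apply: dtotal_hom => i; apply: gr_hom_comp (dinj_hom W i) hf. Qed.

Lemma dmapE i x : dproj i (dmap x) = f (dproj i x).
Proof.
have [ux hx] := dsuppP x; rewrite (lin_sum (dproj_hom _ i).1).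
have [ks|ks] := boolP (i \in dsupp x).
  rewrite (bigD1_seq i ks ux) /= dprojK big1 ?addr0 // => k ki.
  by rewrite dproj_neq // eq_sym.
rewrite hx // (lin0 hf.1) big_seq big1 // => k k_; rewrite dproj_neq //.
by apply: contraNneq ks => ->.
Qed.

Lemma dmap_ex (y : dsum W) : (forall i, exists x, f x = dproj i y) -> exists x, dmap x = y.
Proof.
(* Choosing 0 as the preimage of 0 keeps the support of the chosen family finite. *)
move=> h; have /choice [x xP] i : exists x, f x = dproj i y /\ (dproj i y = 0 -> x = 0).
  have [y0|y0] := pselect (dproj i y = 0); first by exists 0; rewrite (lin0 hf.1).
  by have [x xE] := h i; exists x.
have [s [us hs]] := dproj_supp y.
have [i /hs /(proj2 (xP i)) //|z zP] := @dsum_mk _ x s.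
by exists z; apply: dsum_eq => i; rewrite dmapE zP (xP i).1.
Qed.

End Map.

Section Resolution.
Variables (N : grmod A) (P : grres N).

Lemma dsum_exact (U V W : grmod A) (f : U -> V) (g : V -> W) : gr_hom f -> gr_hom g ->
  (forall x, g x = 0 <-> exists y, f y = x) ->
  forall x, dmap g x = 0 <-> exists y, dmap f y = x.
Proof.
move=> hf hg ex x; split=> [gx|[y <-]].
  apply: dmap_ex => // i; apply/ex; rewrite -(dmapE hg) gx.
  exact: lin0 (dproj_hom _ i).1.
apply: dsum_eq => i; rewrite !dmapE // (lin0 (dproj_hom _ i).1).
by apply/ex; exists (dproj i y).
Qed.

(** The index set is arbitrary: it will be M/JM itself, with one copy of k for each element. *)
Definition dsum_res : grres (dsum N).
Proof.
apply: (@GrRes _ _ (dsum N) (fun n => dsum (P n)) (fun n => dmap (@bd _ _ _ P n))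
  (dmap (@aug _ _ _ P))) => [n|n||y||n].
- exact/dsum_projective/term_projective.
- exact/dmap_hom/bd_hom.
- exact/dmap_hom/aug_hom.
- by apply: (dmap_ex (aug_hom P)) => i; apply: aug_surj.
- by apply: dsum_exact; [exact: bd_hom | exact: aug_hom | exact: exact_aug].
- by apply: dsum_exact; [exact: bd_hom | exact: bd_hom | exact: exact_bd].
Defined.

End Resolution.

End DirectSums.

(** * Homogeneous maps and comparison of resolutions *)

Section HomogeneousMaps.
Variables (F : fieldType) (A : gralg F).
Implicit Types (L M N X Y Q : grmod A).

(** With the convention [M(n)_j = M_{j-n}], a map of degree [n] lowers degrees by [n]. *)
Definition hom_deg M N (n : int) (f : M -> N) := @gr_hom _ _ M (shift N n) f.

Lemma hom_degP M N n (f : M -> N) : hom_deg n f <->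
  linear f /\ forall j x, mcomp j x -> @mcomp _ _ N (j - n) (f x).
Proof. by []. Qed.

Lemma hom_deg_gr M N (f : M -> N) : gr_hom f -> hom_deg 0 f.
Proof. by move=> [lf hf]; split=> // j x /hf; rewrite /= /shift_comp subr0. Qed.

Lemma gr_hom_shift M N (f : M -> N) n : gr_hom f -> @gr_hom _ _ (shift M n) (shift N n) f.
Proof. by move=> [lf hf]; split=> // j x; apply: hf. Qed.

Lemma hom_deg_comp L M N m n (f : M -> N) (g : L -> M) :
  hom_deg m f -> hom_deg n g -> hom_deg (n + m) (f \o g).
Proof.
move=> /hom_degP[lf hf] /hom_degP[lg hg]; apply/hom_degP; split; first exact: linear_comp.
by move=> j x /hg /hf; rewrite opprD addrA.
Qed.

Lemma hom_degD M N n (f g : M -> N) :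
  hom_deg n f -> hom_deg n g -> hom_deg n (fun x => f x + g x).
Proof.
move=> /hom_degP[lf hf] /hom_degP[lg hg]; apply/hom_degP; split=> [a x y|j x xj].
  by rewrite lf lg scalerDr addrACA.
by apply: mcompD; [exact: hf | exact: hg].
Qed.

Lemma hom_deg0 M N n : hom_deg n (fun _ : M => 0 : N).
Proof.
apply/hom_degP; split=> [a x y|j x _]; first by rewrite scaler0 addr0.
exact: mcomp0.
Qed.

Lemma uHomP M N (f : M -> N) : uHom f <-> exists (s : seq int) (g : int -> M -> N),
  [/\ uniq s, forall n, n \notin s -> forall x, g n x = 0, forall n, hom_deg n (g n)
    & forall x, f x = \sum_(n <- s) g n x].
Proof.
split=> [[s [g [hg fE]]]|[s [g [_ _ hg fE]]]]; last by exists s, g.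
exists (undup s), (fun n x => g n x *+ count_mem n s); split=> [|n|n|x].
- exact: undup_uniq.
- by rewrite mem_undup => /count_memPn -> x.
- elim: (count_mem n s) => [|k IH]; first exact: hom_deg0.
  have -> : (fun x => g n x *+ k.+1) = (fun x => g n x + g n x *+ k).
    by apply/funext => x; rewrite mulrS.
  exact: (hom_degD (hg n) IH).
- by rewrite fE -big_undup_iterop_count.
Qed.

Lemma uHom_linear M N (f : M -> N) : uHom f -> linear f.
Proof.
move=> [s [g [hg fE]]] a x y; rewrite !fE scaler_sumr -big_split.
by apply: eq_bigr => n _; have /hom_degP[-> _] := hg n.
Qed.

Lemma uHom_ext M N (f g : M -> N) : (forall x, f x = g x) -> uHom f -> uHom g.
Proof. by move=> e [s [h [hh hE]]]; exists s, h; split=> // x; rewrite -e. Qed.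

Lemma uHom_deg M N n (f : M -> N) : hom_deg n f -> uHom f.
Proof.
move=> hf; exists [:: n], (fun m => if m == n then f else fun=> 0); split=> [m|x].
  by case: eqP => [->//|_]; exact: hom_deg0.
by rewrite big_seq1 eqxx.
Qed.

Lemma uHom_gr M N (f : M -> N) : gr_hom f -> uHom f.
Proof. by move/hom_deg_gr/uHom_deg. Qed.

Lemma uHom0 M N : uHom (fun _ : M => 0 : N).
Proof. exact/uHom_deg/(hom_deg0 _ _ 0). Qed.

Lemma uHomD M N (f g : M -> N) : uHom f -> uHom g -> uHom (fun x => f x + g x).
Proof.
move=> /uHomP[s [f' [us f0 hf fE]]] /uHomP[t [g' [ut g0 hg gE]]].
exists (undup (s ++ t)), (fun n x => f' n x + g' n x); split=> [n|x].
  exact: hom_degD.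
rewrite big_split fE gE /=; congr (_ + _); apply: sum_widen; rewrite ?undup_uniq // => n.
- by move/f0.
- by rewrite mem_undup mem_cat negb_or => /andP[/f0].
- by move/g0.
- by rewrite mem_undup mem_cat negb_or => /andP[_ /g0].
Qed.

Lemma uHom_sum M N (I : Type) (s : seq I) (f : I -> M -> N) :
  (forall i, uHom (f i)) -> uHom (fun x => \sum_(i <- s) f i x).
Proof.
move=> hf; elim: s => [|i s IH].
  by apply: uHom_ext (uHom0 _ _) => x; rewrite big_nil.
by apply: uHom_ext (uHomD (hf i) IH) => x; rewrite big_cons.
Qed.

Lemma uHom_comp L M N (f : M -> N) (g : L -> M) : uHom f -> uHom g -> uHom (f \o g).
Proof.
move=> [s [f' [hf fE]]] [t [g' [hg gE]]].
have : uHom (fun x => \sum_(n <- s) \sum_(m <- t) f' n (g' m x)).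
  apply: uHom_sum => n; apply: uHom_sum => m.
  exact: uHom_deg (hom_deg_comp (hf n) (hg m)).
apply: uHom_ext => x /=; rewrite fE; apply: eq_bigr => n _.
by rewrite gE (lin_sum (hf n).1).
Qed.

Lemma uHomN M N (f : M -> N) : uHom f -> uHom (fun x => - f x).
Proof.
move=> [s [g [hg fE]]]; exists s, (fun n x => - g n x); split=> [n|x].
  have /hom_degP[lg h] := hg n; apply/hom_degP; split=> [a x y|j x xj].
    by rewrite lg opprD scalerN.
  by rewrite -[- g n x]sub0r; apply: (@mcompB _ _ N); [exact: mcomp0 | exact: h].
by rewrite fE sumrN.
Qed.

Lemma uHomB M N (f g : M -> N) : uHom f -> uHom g -> uHom (fun x => f x - g x).
Proof. by move=> hf /uHomN; apply: uHomD. Qed.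

(** On an element of degree j, the summand of [f] of degree n is the part of the value in degree j -
    n. The image of [p] is graded, so it contains the values of each summand, and the summands lift
    one by one. *)
Lemma uHom_lift Q X Y (p : X -> Y) (f : Q -> Y) :
  gr_projective Q -> gr_hom p -> uHom f -> (forall x, exists y, p y = f x) ->
  exists2 g : Q -> X, uHom g & forall x, p (g x) = f x.
Proof.
move=> pQ hp /uHomP[s [f' [us f0 hf fE]]] fp.
have f'p n x : exists y, p y = f' n x.
  have hom j y : mcomp j y -> exists z, p z = f' n y.
    move=> yj; have [ns|/f0 ->] := boolP (n \in s); last by exists 0; exact: lin0 hp.1.
    have [z zE] := fp y; exists (gproj (j - n) z).
    rewrite (gr_hom_proj _ _ hp) zE fE gproj_bigsum (bigD1_seq n) //= big1 ?addr0.
      by apply: gproj_id; apply: (hf n).2.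
    move=> m mn; have /hom_degP[_ h] := hf m; rewrite (gproj_hom _ (h _ _ yj)).
    by rewrite (inj_eq (addrI _)) eqr_opp eq_sym (negbTE mn).
  have [t [_ _ ->]] := gproj_sum x.
  rewrite (lin_sum (hf n).1); apply: (big_ind (fun u => exists y, p y = u)) => [|u v [u' <-] [v' <-]|j _].
  - by exists 0; exact: lin0 hp.1.
  - by exists (u' + v'); rewrite (linD hp.1).
  - by apply: hom (gprojP j x).
have /choice [g gP] n : exists g : Q -> X, hom_deg n g /\ forall x, p (g x) = f' n x.
  by have [g hg gE] := gr_lift pQ (gr_hom_shift n hp) (hf n) (f'p n); exists g.
exists (fun x => \sum_(n <- s) g n x).
  by exists s, g; split=> // n; have [] := gP n.
by move=> x; rewrite (lin_sum hp.1) fE; apply: eq_bigr => n _; have [_ ->] := gP n.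
Qed.

End HomogeneousMaps.

Section Resolutions.
Variables (F : fieldType) (A : gralg F).
Implicit Types (L M N X Y Q : grmod A).

Lemma syz_im M (P : grres M) n (y : P n) : syz y <-> exists z, bd z = y.
Proof. by case: n y => [|n] y; [exact: exact_aug | exact: exact_bd]. Qed.

Lemma bd_bd M (P : grres M) n (x : P n.+2) : bd (bd x) = 0.
Proof. by apply/exact_bd; exists x. Qed.

Lemma aug_bd M (P : grres M) (x : P 1%N) : aug (bd x) = 0.
Proof. by apply/exact_aug; exists x. Qed.

Lemma syz_bd M (P : grres M) n (x : P n.+1) : syz (bd x).
Proof. by apply/syz_im; exists x. Qed.

Lemma minimal_bd M (P : grres M) n (x : P n.+1) : minimal P -> JM (bd x).
Proof. by move=> mP; apply: mP; apply: syz_bd. Qed.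

(** * Comparison of a complex of projectives with a resolution *)

Section ChainMaps.
Variables (C : nat -> grmod A) (dC : forall j, C j.+1 -> C j).
Hypotheses (pC : forall j, gr_projective (C j)) (hdC : forall j, gr_hom (@dC j))
  (dC2 : forall j x, dC (@dC j.+1 x) = 0).
Variables (L : grmod A) (P : grres L).

(* [K] is instantiated with [gr_hom] and with [uHom]. *)
Lemma chain_map_exists (K : forall X Y : grmod A, (X -> Y) -> Prop) (f : C 0%N -> L) :
  (forall (X Y : grmod A) (u : X -> Y), K _ _ u -> linear u) ->
  (forall (X Y Z : grmod A) (u : Y -> Z) (v : X -> Y), K _ _ u -> gr_hom v ->
    K X Z (u \o v)) ->
  (forall (Q X Y : grmod A) (p : X -> Y) (u : Q -> Y), gr_projective Q -> gr_hom p -> K _ _ u ->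
    (forall x, exists y, p y = u x) -> exists2 v : Q -> X, K _ _ v & forall x, p (v x) = u x) ->
  K _ _ f -> (forall x, f (dC x) = 0) ->
  exists phi : forall j, C j -> P j, [/\ forall j, K _ _ (phi j),
    forall x, aug (phi 0%N x) = f x & forall j x, bd (phi j.+1 x) = phi j (dC x)].
Proof.
move=> Klin Kcomp Klift Kf fd.
(* The recursion carries along exactly what the next lift needs: [phi] composed with [dC] lands in
   the syzygies. *)
pose T j := {phi : C j -> P j | K _ _ phi /\ forall x, syz (phi (dC x))}.
have [phi0 [K0 aug0]] : exists phi : C 0%N -> P 0%N, K _ _ phi /\ forall x, aug (phi x) = f x.
  have [x|phi Kp pE] := Klift _ _ _ _ _ (@pC 0%N) (aug_hom P) Kf.
    exact: aug_surj.
  by exists phi.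
have syz0 x : syz (phi0 (dC x)) by rewrite /syz /= aug0 fd.
have step j (t : T j) : {t' : T j.+1 | forall x, bd (sval t' x) = sval t (dC x)}.
  apply: cid; case: t => phi [Kp sp] /=.
  have [x|psi Kq qE] := Klift _ _ _ _ _ (@pC j.+1) (bd_hom P j) (Kcomp _ _ _ _ _ Kp (hdC j)).
    by apply/syz_im; exact: sp.
  have sq x : syz (psi (dC x)) by rewrite /syz /= qE /= dC2 (lin0 (Klin _ _ _ Kp)).
  by exists (exist _ psi (conj Kq sq)).
pose t := nat_rect T (exist _ phi0 (conj K0 syz0)) (fun j u => sval (step j u)).
exists (fun j => sval (t j)); split=> [j|//|j x]; first exact: (svalP (t j)).1.
exact: svalP (step j (t j)) x.
Qed.

Lemma homotopy_exists (delta : forall j, C j -> P j) :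
  (forall j, uHom (delta j)) -> (forall x, aug (delta 0%N x) = 0) ->
  (forall j x, bd (delta j.+1 x) = delta j (dC x)) ->
  exists s : forall j, C j -> P j.+1, [/\ forall j, uHom (s j),
    forall x, delta 0%N x = bd (s 0%N x)
    & forall j x, delta j.+1 x = bd (s j.+1 x) + s j (dC x)].
Proof.
move=> hd d0 dS.
pose T j := {s : C j -> P j.+1 | uHom s /\
  forall x, bd (delta j.+1 x - s (dC x)) = 0}.
have [s0 [us0 s0E]] : exists s : C 0%N -> P 1%N, uHom s /\ forall x, bd (s x) = delta 0%N x.
  have [x|s us sE] := uHom_lift (@pC 0%N) (bd_hom P 0) (hd 0%N).
    exact/exact_aug.
  by exists s.
have s0P x : bd (delta 1%N x - s0 (dC x)) = 0.
  by rewrite (linB (bd_hom P 0).1) dS s0E subrr.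
have step j (t : T j) : {t' : T j.+1 | forall x,
    bd (sval t' x) = delta j.+1 x - sval t (dC x)}.
  apply: cid; case: t => s [us sP] /=.
  have ud : uHom (fun x => delta j.+1 x - s (dC x)).
    by apply: uHomB => //; apply: uHom_comp us _; apply/uHom_gr/hdC.
  have [x|s' us' s'E] := uHom_lift (@pC j.+1) (bd_hom P j.+1) ud.
    by apply/exact_bd; apply: sP.
  have s'P x : bd (delta j.+2 x - s' (dC x)) = 0.
    rewrite (linB (bd_hom P j.+1).1) dS s'E dC2 (lin0 (uHom_linear us)).
    by rewrite subr0 subrr.
  by exists (exist _ s' (conj us' s'P)).
pose t := nat_rect T (exist _ s0 (conj us0 s0P)) (fun j u => sval (step j u)).
exists (fun j => sval (t j)); split=> [j|x|j x]; first exact: (svalP (t j)).1.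
  by rewrite /= s0E.
by have /= -> := svalP (step j (t j)) x; rewrite subrK.
Qed.

(** A chain map over 0 is null-homotopic, and both terms of [bd s + s dC] lie in J P because both
    differentials take values in J. *)
Lemma chain_map_JM (delta : forall j, C j -> P j) : minimal P -> (forall j x, JM (@dC j x)) ->
  (forall j, uHom (delta j)) -> (forall x, aug (delta 0%N x) = 0) ->
  (forall j x, bd (delta j.+1 x) = delta j (dC x)) ->
  forall j x, JM (delta j x).
Proof.
move=> mP mC hd d0 dS; have [s [us s0 sS]] := homotopy_exists hd d0 dS.
move=> [|j] x; first by rewrite s0; apply: minimal_bd.
rewrite sS; apply: JMD; first exact: minimal_bd.
exact: JM_hom (uHom_linear (us j)) (mC j x).
Qed.

End ChainMaps.

Lemma uHom_chain_lift L M (P : grres L) (Q : grres M) n (f : Q n -> L) :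
  cocycle f -> exists phi, chain_lift (P := P) f phi.
Proof.
move=> [uf fd].
have [j|j|j x|X Y u|X Y Z u v hu hv|Q' X Y p u pQ hp hu pu|||phi [h1 h2 h3]] :=
  @chain_map_exists (fun j => Q (j + n)%N) (fun j => @bd _ _ _ Q (j + n)%N) _ _ _ L P
    (fun X Y => @uHom _ _ X Y) f.
- exact: term_projective.
- exact: bd_hom.
- exact: bd_bd.
- exact: uHom_linear.
- by apply: uHom_comp hu (uHom_gr hv).
- exact: uHom_lift.
- exact: uf.
- exact: fd.
- by exists phi.
Qed.

Lemma chain_lift_unique L M (P : grres L) (Q : grres M) n (f : Q n -> L) phi psi :
  minimal P -> minimal Q -> chain_lift (P := P) f phi -> chain_lift f psi ->
  forall j x, JM (phi j x - psi j x).
Proof.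
move=> mP mQ [h1 h2 h3] [k1 k2 k3].
apply: (@chain_map_JM (fun j => Q (j + n)%N) (fun j => @bd _ _ _ Q (j + n)%N) _ _ _ L P) => //.
- by move=> j; apply: term_projective.
- by move=> j; apply: bd_hom.
- by move=> j x; apply: bd_bd.
- by move=> j x; apply: minimal_bd.
- by move=> j; apply: uHomB.
- by move=> x; rewrite (linB (aug_hom P).1) h2 k2 subrr.
- by move=> j x; rewrite (linB (bd_hom P j).1) h3 k3.
Qed.

Definition gr_chain M N (Q : grres M) (P : grres N) (phi : forall j, Q j -> P j) :=
  (forall j, gr_hom (phi j)) /\ forall j x, bd (phi j.+1 x) = phi j (bd x).

Lemma gr_chain_exists M N (Q : grres M) (P : grres N) (f : Q 0%N -> N) :
  gr_hom f -> (forall x, f (bd x) = 0) ->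
  exists phi : forall j, Q j -> P j, gr_chain phi /\ forall x, aug (phi 0%N x) = f x.
Proof.
move=> hf fd.
have [j|j|j x|X Y u|X Y Z u v|Q' X Y p u|||phi [h1 h2 h3]] :=
  @chain_map_exists Q (@bd _ _ _ Q) _ _ _ N P (fun X Y => @gr_hom _ _ X Y) f.
- exact: term_projective.
- exact: bd_hom.
- exact: bd_bd.
- by case.
- exact: gr_hom_comp.
- exact: gr_lift.
- exact: hf.
- exact: fd.
- by exists phi.
Qed.

Lemma gr_chain_comp L M N (P : grres L) (Q : grres M) (R : grres N)
    (phi : forall j, Q j -> R j) (psi : forall j, P j -> Q j) :
  gr_chain phi -> gr_chain psi -> gr_chain (fun j => phi j \o psi j).
Proof.
move=> [hp bp] [hq bq]; split=> [j|j x /=]; first exact: gr_hom_comp.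
by rewrite bp bq.
Qed.

Lemma gr_chain_id_JM M (Q : grres M) (phi : forall j, Q j -> Q j) : minimal Q ->
  gr_chain phi -> (forall x, aug (phi 0%N x) = aug x) -> forall j x, JM (x - phi j x).
Proof.
move=> mQ [hp bp] p0.
apply: (@chain_map_JM Q (@bd _ _ _ Q) _ _ _ M Q (fun j x => x - phi j x)) => //.
- by move=> j; apply: term_projective.
- by move=> j; apply: bd_hom.
- by move=> j x; apply: bd_bd.
- by move=> j x; apply: minimal_bd.
- by move=> j; apply/uHom_gr/gr_hom_sub.
- by move=> x; rewrite (linB (aug_hom Q).1) p0 subrr.
- by move=> j x; rewrite (linB (bd_hom Q j).1) bp.
Qed.

(** The identity of [M] is lifted in both directions; [psi] after [phi] is homotopic to the identity
    of [Q], and by minimality homotopic maps agree modulo J. *)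
Lemma minimal_compare M (Q Q' : grres M) : minimal Q ->
  exists (phi : forall j, Q j -> Q' j) (psi : forall j, Q' j -> Q j),
  [/\ gr_chain phi, gr_chain psi, forall x, aug (phi 0%N x) = aug x
    & forall j x, JM (x - psi j (phi j x))].
Proof.
move=> mQ.
have [phi [cp p0]] := gr_chain_exists Q' (aug_hom Q) (@aug_bd _ Q).
have [psi [cq q0]] := gr_chain_exists Q (aug_hom Q') (@aug_bd _ Q').
exists phi, psi; split=> //.
by apply: (gr_chain_id_JM mQ (gr_chain_comp cq cp)) => x /=; rewrite q0 p0.
Qed.

End Resolutions.

(** * Separation and semisimplicity *)

Section ProjectiveSeparation.
Variables (F : fieldType) (A : gralg F).
Implicit Types (L M N X Y Q : grmod A).

Lemma geq_deg_add M l (x y : M) : geq_deg l x -> geq_deg l y -> geq_deg l (x + y).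
Proof. by move=> xl yl j jl; rewrite gprojD xl // yl // addr0. Qed.

Lemma geq_deg_zero M l : geq_deg l (0 : M).
Proof. by move=> j _; rewrite gproj0. Qed.

Lemma geq_deg_scale M l (a : A) (x : M) : geq_deg l x -> geq_deg l (a *: x).
Proof.
move=> xl j ji; have [s [_ _ ->]] := gproj_sum x.
rewrite scaler_sumr gproj_bigsum big1 // => k _; rewrite (gproj_scale _ _ (gprojP _ _)).
have [kl|lk] := ltP k l; first by rewrite xl // scaler0.
have : j - k < 0 by rewrite subr_lt0; apply: lt_le_trans lk.
by move: (gprojP (j - k) (a : regmod A)); case: (j - k) => // n /= ->; rewrite scale0r.
Qed.

Lemma geq_deg_proj M l j (x : M) : geq_deg l x -> geq_deg l (gproj j x).
Proof.
by move=> xl i il; rewrite (gproj_hom _ (gprojP j x)); case: eqP => // <-; apply: xl.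
Qed.

Lemma geq_deg_sum M l (T : Type) (s : seq T) (f : T -> M) :
  (forall t, geq_deg l (f t)) -> geq_deg l (\sum_(t <- s) f t).
Proof. by move=> h j jl; rewrite gproj_bigsum big1 // => t _; apply: h. Qed.

Definition truncation M (l : int) : gsubmod M :=
  @GSubmod _ _ M (@geq_deg _ _ M l) (@geq_deg_add M l) (@geq_deg_scale M l)
    (@geq_deg_zero M l) (@geq_deg_proj M l).

Lemma geq_deg_radJ M l (a : A) (x : M) : radJ a -> geq_deg l x -> geq_deg (l + 1) (a *: x).
Proof.
move=> [n [f [fA ->]]] xl j jl; rewrite scaler_suml gproj_bigsum big1 // => i _.
have [s [_ _ ->]] := gproj_sum x.
rewrite scaler_sumr gproj_bigsum big1 // => k _.
rewrite (gproj_hom _ (mcompZ (fA i) (gprojP k x))); case: eqP => // jE.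
rewrite xl ?scaler0 //; have : i.+1%:Z + k < l + 1 by rewrite -jE.
rewrite intS [1 + _]addrC addrAC ltrD2r; apply: le_lt_trans.
by rewrite lerDr.
Qed.

Lemma exists_lower_bound (s : seq int) : exists n : nat, forall j, j \in s -> - n%:Z <= j.
Proof.
elim: s => [|j r [n nP]]; first by exists 0%N.
exists (maxn n `|j|%N) => k; rewrite inE lerNl => /predU1P[->|/nP nk].
  by apply: le_trans (ler_norm _) _; rewrite normrN -abszE lez_nat leq_maxr.
by rewrite lerNl in nk; apply: le_trans nk _; rewrite lez_nat leq_maxl.
Qed.

(* If x = w x with w Q in J Q, then x lies in every J^n Q.  As Q is a summand of
   the direct sum of its truncations Q_{>= -i}, i in nat, the J^n Q intersect in 0. *)
Lemma projective_fixpoint Q (w : Q -> Q) x : gr_projective Q -> linear w ->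
  (forall y, JM (w y)) -> w x = x -> x = 0.
Proof.
move=> pQ lw wJ wx.
pose T (y : dsum nat Q) := forall i : nat, geq_deg (- i%:Z) (dproj i y).
have TD y z : T y -> T z -> T (y + z).
  by move=> Ty Tz i; rewrite (linD (dproj_hom Q i).1); apply: geq_deg_add.
have TZ (a : A) y : T y -> T (a *: y).
  by move=> Ty i; rewrite (linZ (dproj_hom Q i).1); apply: geq_deg_scale.
have T0 : T 0 by move=> i; rewrite (lin0 (dproj_hom Q i).1); apply: geq_deg_zero.
have TP j y : T y -> T (gproj j y).
  by move=> Ty i; rewrite (gr_hom_proj _ _ (dproj_hom Q i)); apply: geq_deg_proj.
pose S := @GSubmod _ _ _ T TD TZ T0 TP.
pose p (y : gsmod S) : Q := dtotal (fun _ : nat => id) (gs_val y).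
have hid : nat -> gr_hom (@id Q) by move=> _; exact: gr_hom_id.
have hp : gr_hom p.
  apply: (gr_hom_comp (f := dtotal (fun _ : nat => id))); last exact: gs_val_hom.
  exact: dtotal_hom.
have sp y : exists z, p z = y.
  have [s [us s0 _]] := gproj_sum y.
  have [n nP] := exists_lower_bound s.
  have Ty : S (dinj n y).
    move=> i; have [->|ni] := eqVneq i n; last by rewrite dproj_neq //; exact: geq_deg_zero.
    by rewrite dprojK => j jn; apply: s0; apply: contraTN jn => /nP; rewrite -leNgt.
  exists (gs_of Ty); rewrite /p (dtotal_one hid (i := n)) /= ?dprojK // => k kn.
  exact: dproj_neq.
have [s hs ps] := pQ _ _ p id hp (gr_hom_id Q) sp.
(* The i-th coordinate of the section [s] starts in degree -i. Each application of [w] yields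
   coefficients in J, which pass through the linear maps and raise this bound by one. *)
have key n y i : geq_deg (n%:Z - i%:Z) (dproj i (gs_val (s (iter n w y)))).
  elim: n y => [|n IH] y; first by rewrite sub0r; apply: (gs_valP (s y)).
  rewrite iterSr; have [m [a [q [aq ->]]]] := wJ y.
  have liw : linear (iter n w).
    by elim: (n) => [//|k lk] b u v /=; rewrite lk lw.
  pose h q := dproj i (gs_val (s q)).
  have lh : linear h.
    exact: linear_comp (dproj_hom Q i).1 (linear_comp (@gs_val_linear _ _ _ S) hs.1).
  rewrite -[dproj i _]/(h _) (lin_sum liw) (lin_sum lh); apply: geq_deg_sum => k.
  rewrite (linZ liw) (linZ lh) intS [1 + _]addrC addrAC.
  by apply: geq_deg_radJ (IH _); have [] := aq k.
rewrite -[x]ps; suff -> : s x = 0 by exact: lin0 hp.1.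
apply: gs_val_inj; rewrite (lin0 (@gs_val_linear _ _ _ S)).
apply: dsum_eq => i; rewrite (lin0 (dproj_hom Q i).1); apply: gproj_eq0 => j.
have wn n : iter n w x = x by elim: n => //= n ->.
(* For n = |j + i| + 1 the degree j lies below n - i, where the coordinate vanishes. *)
rewrite -(wn (absz (j + i%:Z)%R).+1); apply: key.
rewrite ltrBrDr; apply: le_lt_trans (ler_norm _) _.
by rewrite -abszE ltz_nat.
Qed.

(** As [N] vanishes below [l], the truncation of [Q] at [l] has the same image under [p], so [p]
    lifts to a map [v] into it. Then y - v(y) lies in ker [p], hence in J Q, and an element of
    degree below [l] is fixed by this difference because [v] kills it. *)
Lemma minimal_cover_below Q N (p : Q -> N) l : gr_projective Q -> gr_hom p ->
  (forall x, p x = 0 -> JM x) -> below N l -> below Q l.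
Proof.
move=> pQ hp kp bN; pose S := truncation Q l.
have hpS : @gr_hom _ _ (gsmod S) N (p \o @gs_val _ _ _ S).
  by apply: gr_hom_comp => //; exact: gs_val_hom.
have [x|v hv vE] := gr_lift pQ hpS hp.
  have [s [_ _ xE]] := gproj_sum x.
  have Sy : S (\sum_(j <- s | l <= j) gproj j x).
    move=> i il; rewrite gproj_bigsum big1 // => j lj.
    rewrite (gproj_hom _ (gprojP j x)); case: eqP => // ij.
    by rewrite ij ltNge lj in il.
  exists (gs_of Sy) => /=; rewrite [in RHS]xE !(lin_sum hp.1) [RHS](bigID (fun j => l <= j)) /=.
  rewrite [X in _ + X]big1 ?addr0 // => j; rewrite -ltNge => jl.
  by apply: bN jl _; apply: hp.2; apply: gprojP.
move=> j x jl xj; pose w y := y - gs_val (v y).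
have lv := linear_comp (@gs_val_linear _ _ _ S) hv.1.
apply: (projective_fixpoint (w := w)) => //.
- by apply: linear_sub.
- by move=> y; apply: kp; rewrite (linB hp.1) -[p (gs_val _)]/((p \o @gs_val _ _ _ S) (v y)) vE subrr.
- rewrite /w; have := gs_valP (v x) j jl; rewrite gproj_id; last exact: hv.2 xj.
  by move=> ->; rewrite subr0.
Qed.

Lemma minimal_below M (Q : grres M) l n : minimal Q -> below M l -> below (Q n) l.
Proof.
move=> mQ bM; elim: n => [|n IH].
  by apply: minimal_cover_below (aug_hom Q) (mQ 0%N) bM; exact: term_projective.
by apply: minimal_cover_below (bd_hom Q n) (mQ n.+1) IH; exact: term_projective.
Qed.

End ProjectiveSeparation.

(** * Modules over the semisimple ring A_0 are injective *)

Section Semisimple.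
Variables (F : fieldType) (A : gralg F).
Hypothesis ssA : semisimple0 A.

Local Notation A0 := (@acomp F A 0%N).

Lemma A0M (a b : A) : A0 a -> A0 b -> A0 (a * b).
Proof. by move=> a0 b0; have := acompM a0 b0. Qed.

Lemma A0D (a b : A) : A0 a -> A0 b -> A0 (a + b).
Proof. exact: (idsD (acomp_sum A)). Qed.

Lemma A0B (a b : A) : A0 a -> A0 b -> A0 (a - b).
Proof. exact: (idsB (acomp_sum A)). Qed.

(** Write 1 = e + y along a complement of [I]. For a in [I] the product a y = a - a e lies in both
    summands, hence is 0. *)
Lemma ideal_idempotent (I : set A) : left_ideal0 I ->
  exists e, [/\ A0 e, I e & forall a, I a -> a = a * e].
Proof.
move=> lI; have [I' [lI' II' dec]] := ssA lI.
have [x [y [Ix Iy e1]]] := dec 1 (acomp1 A).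
have [sI [_ IB] IM] := lI; have [sI' _ IM'] := lI'.
exists x; split=> //; first exact: sI.
move=> a Ia; have a0 := sI a Ia.
have : (I `&` I') (a * y).
  split; last exact: IM'.
  have -> : a * y = a - a * x by rewrite -{2}[a]mulr1 e1 mulrDr addrAC subrr add0r.
  by apply: IB => //; apply: IM.
by rewrite II' => ay; rewrite -{1}[a]mulr1 e1 mulrDr ay addr0.
Qed.

Section Extension.
Variables (V N : lmodType A).

(** By linearity, the last clause says that the graph is single-valued. *)
Let partial_map (G : set (V * N)) : Prop := [/\ G 0,
  forall (a : A) u v, A0 a -> G u -> G v -> G (a *: u + v)
  & forall n, G (0, n) -> n = 0].

Let pmD G u v : partial_map G -> G u -> G v -> G (u + v).
Proof. by move=> [_ h _] Gu Gv; rewrite -[u]scale1r; apply: h => //; apply: acomp1. Qed.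

Let pmZ G (a : A) u : partial_map G -> A0 a -> G u -> G (a *: u).
Proof. by move=> [G0 h _] a0 Gu; rewrite -[_ *: _]addr0; apply: h. Qed.

(** The a in A_0 for which [a *: y] is in the domain form a left ideal, generated by an
    idempotent-like [e] with a = a e. The value [n0] of the partial map at [e *: y] can then be
    assigned to [y] without conflict. *)
Let pm_extend G y : partial_map G ->
  exists G' n, [/\ partial_map G', G `<=` G' & G' (y, n)].
Proof.
move=> pG; have [G0 GZD Gf] := pG.
have A01 := acomp1 A.
have A0N (a : A) : A0 a -> A0 (- a).
  by move=> a0; rewrite -sub0r; apply: A0B a0; exact: (ids0 (acomp_sum A)).
have [|e [e0 [_ [n0 Gn0]] eI]] := @ideal_idempotent [set a | A0 a /\ exists n, G (a *: y, n)].
  split=> [a []//||a x a0 [x0 [n Gn]]].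
    split=> [|a b [a0 [m Gm]] [b0 [n Gn]]].
      by split; [exact: (ids0 (acomp_sum A)) | exists 0; rewrite scale0r].
    split; first exact: A0B.
    exists (m - n); have := GZD (-1) (b *: y, n) (a *: y, m) (A0N _ A01) Gn Gm.
    by rewrite !scaleN1r addrC /= scalerBl.
  by split; [exact: A0M | exists (a *: n); rewrite -scalerA; apply: (pmZ pG a0 Gn)].
have h : forall u m (a : A), A0 a -> G (u, m) -> u + a *: y = 0 -> m + a *: n0 = 0.
  move=> u m a a0 Gu u0.
  have aI : a = a * e.
    apply: eI; split=> //; exists (- m).
    have -> : (a *: y, - m) = (-1 : A) *: (u, m) :> V * N.
      apply/pair_equal_spec; rewrite /= !scaleN1r; split=> //.
      by apply/eqP; rewrite -addr_eq0 addrC; apply/eqP.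
    exact: (pmZ pG (A0N _ A01) Gu).
  apply: Gf; have <- : u + a *: (e *: y) = 0 by rewrite scalerA -aI.
  exact: (pmD pG Gu (pmZ pG a0 Gn0)).
pose G' : set (V * N) := [set w | exists u m (a : A),
  [/\ A0 a, G (u, m) & w = (u + a *: y, m + a *: n0)]].
exists G', n0; split.
- split.
  + by exists 0, 0, 0; split=> //; [exact: (ids0 (acomp_sum A)) | rewrite !scale0r !addr0].
  + move=> b _ _ b0 [u [m [a [a0 Gu ->]]]] [u' [m' [a' [a'0 Gu' ->]]]].
    exists (b *: u + u'), (b *: m + m'), (b * a + a'); split.
    * by apply: A0D => //; apply: A0M.
    * exact: GZD b0 Gu Gu'.
    * apply/pair_equal_spec; split=> /=;
        by rewrite scalerDr scalerDl scalerA addrACA.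
  + by move=> n [u [m [a [a0 Gu [/esym u0 ->]]]]]; apply: h u0.
- move=> [u m] Gu; exists u, m, 0; rewrite !scale0r !addr0; split=> //.
  exact: (ids0 (acomp_sum A)).
- by exists 0, 0, 1; rewrite !scale1r !add0r; split.
Qed.

(* Baer's argument: all A_0-modules are injective. The partial map to be extended is
   given by its graph G. *)
Lemma semisimple_extension (G : set (V * N)) : G 0 ->
  (forall (a : A) u v, A0 a -> G u -> G v -> G (a *: u + v)) ->
  (forall n, G (0, n) -> n = 0) ->
  exists g : V -> N, [/\ forall x y, g (x + y) = g x + g y,
    forall a x, A0 a -> g (a *: x) = a *: g x & forall x n, G (x, n) -> g x = n].
Proof.
move=> G0 GZD Gf; have pG : partial_map G by [].
(* Zorn's lemma for unions also covers the empty chain; adjoining [G] makes the empty set admissible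
   and keeps [G] in the maximal graph. *)
pose P X := partial_map (G `|` X).
have [S SP tS|X [PX maxX]] := @Zorn_bigcup (V * N) P.
  have two u v : (G `|` \bigcup_(X in S) X) u -> (G `|` \bigcup_(X in S) X) v ->
      exists Y, [/\ partial_map Y, Y `<=` G `|` \bigcup_(X in S) X, Y u & Y v].
    have sub Y : S Y -> G `|` Y `<=` G `|` \bigcup_(X in S) X.
      by move=> SY w [Gw|Yw]; [left | right; exists Y].
    move=> [Gu|[Y SY Yu]] [Gv|[Z SZ Zv]].
    - by exists G; split=> // w; left.
    - by exists (G `|` Z); split; [exact: SP|exact: sub|left|right].
    - by exists (G `|` Y); split; [exact: SP|exact: sub|right|left].
    - have [YZ|ZY] := tS _ _ SY SZ.
        by exists (G `|` Z); split; [exact: SP|exact: sub|right; apply: YZ|right].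
      by exists (G `|` Y); split; [exact: SP|exact: sub|right|right; apply: ZY].
  split=> [|a u v a0 Su Sv|n Sn]; first by left.
    have [Y [[_ YZD _] sY Yu Yv]] := two u v Su Sv.
    exact/sY/YZD.
  by have [Y [[_ _ Yf] sY Yn _]] := two _ _ Sn Sn; apply: Yf.
have total y : exists n, (G `|` X) (y, n).
  have [G' [n [pG' sG' Gn]]] := pm_extend y PX.
  apply: contrapT => h; apply: (maxX G'); last first.
    by rewrite /P setUidr //; apply: subset_trans sG'; exact: subsetUl.
  split; first by apply: subset_trans sG'; exact: subsetUr.
  by move=> /(_ _ Gn) Xn; apply: h; exists n; right.
have /choice [g gP] := total.
have [_ XZD Xf] := PX.
have guniq x n : (G `|` X) (x, n) -> g x = n.
  move=> Xn; apply/eqP; rewrite -subr_eq0; apply/eqP/Xf.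
  have A0N1 : A0 (-1 : A).
    by rewrite -[-1]sub0r; apply: A0B (acomp1 A); exact: (ids0 (acomp_sum A)).
  have := XZD _ _ _ A0N1 Xn (gP x).
  have -> : (-1 : A) *: (x, n) + (x, g x) = (0, g x - n) :> V * N.
    by apply/pair_equal_spec; rewrite /= !scaleN1r addNr addrC.
  by [].
exists g; split=> [x y|a x a0|x n Gn]; apply: guniq.
- exact: (pmD PX (gP x) (gP y)).
- exact: (pmZ PX a0 (gP x)).
- by left.
Qed.

End Extension.
End Semisimple.

(** * Extending and separating graded maps modulo J *)

Section GradedExtension.
Variables (F : fieldType) (A : gralg F).
Implicit Types (L M N Q R : grmod A).

(** Modulo J a scalar acts through its degree 0 part, which turns A_0-linearity into A-linearity on
    modules killed by J. *)
Lemma acomp0_part (a : A) : exists2 a0, acomp 0%N a0 &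
  forall M (x : M), JM (a *: x - a0 *: x).
Proof.
have [s [us h aE]] := hcomp_sum (acomp_sum A) a.
exists (hcomp (acomp_sum A) a 0%N) => [|M x]; first exact: hcompP.
rewrite -scalerBl {1}aE; have [s0|/h h0] := boolP (0%N \in s).
  rewrite (bigD1_seq 0%N) //= addrAC subrr add0r scaler_suml.
  apply: JM_sum => -[//|i] _; apply: JM_scale; exact: acomp_radJ (hcompP _ _ _).
rewrite h0 subr0 scaler_suml; apply: JM_sum => -[|i] _.
  by rewrite h0 scale0r; exact: JM0.
apply: JM_scale; exact: acomp_radJ (hcompP _ _ _).
Qed.

Lemma gproj_scale0 M j (a : A) (x : M) : acomp 0%N a -> gproj j (a *: x) = a *: gproj j x.
Proof.
move=> a0; have [s [us h {1}->]] := gproj_sum x.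
rewrite scaler_sumr gproj_bigsum.
have E i : gproj j (a *: gproj i x) = if i == j then a *: gproj i x else 0.
  by rewrite (gproj_hom _ (mcompZ a0 (gprojP i x))) add0r eq_sym.
under eq_bigr do rewrite E.
have [js|js] := boolP (j \in s).
  by rewrite (bigD1_seq j js us) /= eqxx big1 ?addr0 // => i /negbTE ->.
rewrite h // scaler0 big_seq big1 // => i si; case: eqP => // ij.
by rewrite -ij si in js.
Qed.

Lemma JM_lowest M l (x : M) : below M l -> mcomp l x -> JM x -> x = 0.
Proof.
move=> bM xl Jx; rewrite -(gproj_id xl).
apply: (JM_hom_ind (S := fun z => z = 0)) (x) Jx => [//|u v -> ->|i a m _ ml].
  by rewrite addr0.
by rewrite (bM _ _ _ ml) ?scaler0 // ltrBlDr ltrDl.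
Qed.

Lemma JM_top M (u : top M) : JM u -> u = 0.
Proof.
move=> [n [a [m [am ->]]]]; rewrite big1 // => i _; have [ai _] := am i.
rewrite -[m i]top_reprK -[_ *: _]/(top_scale _ _) top_scaleE -[RHS]top_pi0.
by apply/top_piE; rewrite subr0; apply: JM_scale.
Qed.

Lemma top_pi_hom M : @gr_hom _ _ M (top M) (@top_pi _ _ M).
Proof.
split=> [a x y|j x xj]; last by exists x.
by rewrite top_piD -[_ *: top_pi x]/(top_scale _ _) top_scaleE.
Qed.

Lemma top_pi_eq0 M (x : M) : top_pi x = 0 <-> JM x.
Proof. by rewrite -(top_pi0 M) top_piE subr0. Qed.

Lemma hom_JM0 M N (f : M -> N) x : linear f -> (forall y : N, JM y -> y = 0) ->
  JM x -> f x = 0.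
Proof. by move=> lf JN /(JM_hom lf) /JN. Qed.

Hypothesis ssA : semisimple0 A.

(** The partial map [Phi q + z |-> f q], with z in J R, is well defined by the last hypothesis and
    extends A_0-linearly to [R]. Putting J R in its kernel is what makes the extension A-linear, as
    [N] is killed by J. *)
Lemma graded_extension Q R N (Phi : Q -> R) (f : Q -> N) : gr_hom Phi -> gr_hom f ->
  (forall y : N, JM y -> y = 0) -> (forall q, JM (Phi q) -> f q = 0) ->
  exists2 g : R -> N, gr_hom g & forall q, g (Phi q) = f q.
Proof.
move=> hP hf JN Pf.
pose G : set (R * N) := [set w | exists q z, JM z /\ w = (Phi q + z, f q)].
have [||n [q [z [Jz [/esym/eqP qz ->]]]]|h [hD hZ hG]] := @semisimple_extension _ _ ssA R N G.
- exists 0, 0; split; first exact: JM0.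
  by rewrite (lin0 hP.1) (lin0 hf.1) addr0.
- move=> a u v _ [q [z [Jz ->]]] [q' [z' [Jz' ->]]].
  exists (a *: q + q'), (a *: z + z'); split; first by apply: JMD => //; apply: JMZ.
  apply/pair_equal_spec; rewrite hP.1 hf.1; split=> //=.
  by rewrite scalerDr addrACA.
- by apply: Pf; move: qz; rewrite addr_eq0 => /eqP ->; rewrite -sub0r; apply: JMB => //; exact: JM0.
have hJ z : JM z -> h z = 0.
  by move=> Jz; rewrite -(lin0 hf.1); apply: hG; exists 0, z; rewrite (lin0 hP.1) add0r.
(* Nothing forces [h] to respect degrees, so [g] retains only its degree-preserving part. *)
have /choice [g gP] x : exists y, forall j, gproj j y = gproj j (h (gproj j x)).
  have [s [us s0 _]] := gproj_sum x.
  exists (\sum_(j <- s) gproj j (h (gproj j x))) => j.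
  rewrite gproj_bigsum.
  under eq_bigr do rewrite (gproj_hom _ (gprojP _ _)).
  have [js|js] := boolP (j \in s).
    rewrite (bigD1_seq j js us) /= eqxx big1 ?addr0 // => i.
    by rewrite eq_sym => /negbTE ->.
  rewrite s0 // hJ ?gproj0; last exact: JM0.
  by rewrite big_seq big1 // => i si; case: eqP => // ij; rewrite ij si in js.
exists g => [|q].
  split=> [a x y|j x xj].
    apply: gproj_eq => j; rewrite gprojD !gP gprojD hD gprojD; congr (_ + _).
    have [a0 a00 aJ] := acomp0_part a.
    have -> : h (gproj j (a *: x)) = a0 *: h (gproj j x).
      rewrite -(subrK (a0 *: x) (a *: x)) gprojD hD hJ ?add0r; last exact/JM_proj/aJ.
      by rewrite gproj_scale0 // hZ.
    rewrite (gproj_scale0 _ _ a00) -gP -(gproj_scale0 _ _ a00); congr (gproj j _).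
    by apply/esym/eqP; rewrite -subr_eq0; apply/eqP/JN/aJ.
  have -> : g x = gproj j (g x) by
    apply: gproj_eq => i; rewrite (gproj_hom _ (gprojP j _)); case: eqP => [->//|/eqP ij];
    rewrite gP (gproj_hom _ xj) (negbTE ij) hJ ?gproj0 //; exact: JM0.
  exact: gprojP.
apply: gproj_eq => j; rewrite gP -(gr_hom_proj _ _ hP) -(gr_hom_proj _ _ hf).
have -> : h (Phi (gproj j q)) = f (gproj j q).
  by apply: hG; exists (gproj j q), 0; rewrite addr0; split=> //; exact: JM0.
by rewrite (gr_hom_proj _ _ hf) (gproj_id (gprojP _ _)).
Qed.

(** The projection of [Q] onto Q/JQ extends along [Phi] to [R], and lifts to [r : R -> Q] with r Phi
    equal to the identity modulo J. An element of ker [Phi] is fixed by [y - r (Phi y)], whose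
    values lie in J Q. *)
Lemma top_injective_injective Q R (Phi : Q -> R) : gr_projective Q -> gr_projective R ->
  gr_hom Phi -> (forall x, JM (Phi x) -> JM x) -> forall x, Phi x = 0 -> x = 0.
Proof.
move=> pQ pR hP PJ.
have [q /PJ /top_pi_eq0 //|g hg gE] :=
  graded_extension hP (top_pi_hom Q) (@JM_top Q).
have [u|r hr rE] := pR _ _ _ _ (top_pi_hom Q) hg; first by exists (top_repr u); apply: top_reprK.
move=> x Px; apply: (projective_fixpoint (w := fun y => y - r (Phi y))) => //.
- by apply: linear_sub => //; exact: linear_comp hr.1 hP.1.
- by move=> y; apply/top_pi_eq0; rewrite (linB (top_pi_hom Q).1) rE gE subrr.
- by rewrite Px (lin0 hr.1) subr0.
Qed.

Lemma regmod_below : below (regmod A) 0.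
Proof. by move=> [j|j] x //= _ ->. Qed.

(** The annihilator of [x] modulo J in A_0 is generated by some [e] with a = a e for all its
    elements, so it also kills the class [u] of 1 - e in k. This class is nonzero, since e = 1 would
    put [x] in J M; hence [a *: x |-> a *: u] is well defined and extends to [M]. *)
Lemma separate_JM M j (x : M) : mcomp j x -> ~ JM x ->
  exists2 g : M -> trivmod A, uHom g & g x <> 0.
Proof.
move=> xj nJ.
have A01 := acomp1 A.
have [|e [e0 [_ Je] eI]] := @ideal_idempotent _ _ ssA [set a | acomp 0%N a /\ JM (a *: x)].
  split=> [a []//||a b a0 [b0 Jb]].
    split=> [|a b [a0 Ja] [b0 Jb]].
      by split; [exact: (ids0 (acomp_sum A)) | rewrite scale0r; exact: JM0].
    by split; [exact: A0B | rewrite scalerBl; apply: JMB].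
  by split; [exact: A0M | rewrite -scalerA; apply: JMZ].
pose u : trivmod A := top_pi ((1 - e : A) : regmod A).
have e10 : acomp 0%N (1 - e) by apply: A0B.
have u0 : mcomp 0 u by exists (1 - e : A).
have nu : u <> 0.
  move=> /top_pi_eq0 /(JM_lowest regmod_below e10) /eqP.
  by rewrite subr_eq0 => /eqP e1; apply: nJ; rewrite -[x]scale1r e1.
have ulin (b : A) : b *: u = top_pi ((b * (1 - e) : A) : regmod A).
  by rewrite -[LHS]/(top_scale _ _) top_scaleE.
pose Phi (a : shift (regmod A) j) : M := (a : A) *: x.
pose f (a : shift (regmod A) j) : shift (trivmod A) j := (a : A) *: u.
have hP : gr_hom Phi.
  split=> [a b c|i a ai]; first by rewrite /Phi scalerDl -scalerA.
  by rewrite -(subrK j i); apply: regcompZ.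
have hf : gr_hom f.
  split=> [a b c|i a ai]; first by rewrite /f scalerDl -scalerA.
  have := regcompZ ai u0; rewrite addr0; exact.
have [y Jy|a Ja|g hg gE] := graded_extension hP hf.
- exact: JM_top Jy.
- have [a0 a00 aJ] := acomp0_part a.
  have Ja0 : JM (a0 *: x).
    by rewrite -[_ *: x](subKr (a *: x)); apply: JMB => //; exact: aJ.
  have a0e := eI a0 (conj a00 Ja0).
  have -> : f a = a0 *: u.
    by apply/eqP; rewrite -subr_eq0; apply/eqP; apply: JM_top; exact: aJ.
  by rewrite ulin mulrBr mulr1 -a0e subrr top_pi0.
exists g; first exact: (uHom_deg (n := j)).
by have := gE 1; rewrite /Phi /f !scale1r => ->.
Qed.

(** Graded Nakayama lemma: in degrees outside [S] an element is a combination of elements of lower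
    degree, and [l] starts the induction. *)
Lemma generated_of_JM M l (S : seq int) : below M l ->
  (forall j (x : M), mcomp j x -> j \notin S -> JM x) -> generated_in M S.
Proof.
move=> bM SJ; set X := [set x : M | exists2 j, j \in S & mcomp j x].
have Xj j (x : M) : mcomp j x -> smul_set setT X x.
  move: j x; apply: (below_ind bM) => [|j IH x xj]; first exact: smul_set0.
  have [jS|jS] := boolP (j \in S).
    by rewrite -[x]scale1r; apply: smul_set1 => //; exists j.
  rewrite -(gproj_id xj).
  apply: (JM_hom_ind (S := smul_set setT X)) (x) (SJ _ _ xj jS) => [|u v|i a m _ mi].
  - exact: smul_set0.
  - exact: smul_setD.
  - by apply: smul_setZ => //; apply: IH mi; rewrite ltrBlDr ltrDl.
apply/seteqP; split=> // x _; have [s [_ _ ->]] := gproj_sum x.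
by apply: big_ind => [|u v|j _]; [exact: smul_set0|exact: smul_setD|exact: Xj (gprojP j x)].
Qed.

End GradedExtension.

(** * Generation of E(M) implies bi-Koszul *)

Section MinimalExt.
Variables (F : fieldType) (A : gralg F).
Implicit Types (L M N : grmod A).

Lemma triv_degree j (u : trivmod A) : j != 0 -> mcomp j u -> u = 0.
Proof.
move=> j0 [a aj <-]; apply/top_pi_eq0; case: j j0 aj => [[//|j]|j] _ /=.
  move=> aj; rewrite -[a]mulr1 -[a * 1]/((a : A) *: (1 : regmod A)).
  exact/JM_scale/acomp_radJ/aj.
by move=> ->; exact: JM0.
Qed.

Lemma uHom_JM0 M (f : M -> trivmod A) x : uHom f -> JM x -> f x = 0.
Proof. by move=> /uHom_linear lf; apply: hom_JM0 lf (@JM_top _ _ _). Qed.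

Section MinimalResolution.
Variables (M : grmod A) (Q : grres M).
Hypothesis mQ : minimal Q.

Lemma minimal_cocycle n (f : Q n -> trivmod A) : uHom f -> cocycle f.
Proof. by move=> uf; split=> // x; apply: uHom_JM0 uf (minimal_bd x mQ). Qed.

Lemma minimal_ext_class n (f : Q n -> trivmod A) : uHom f -> ext_class f = [set f].
Proof.
move=> uf; apply/seteqP; split=> [g [_ gf]|_ ->]; last first.
  split; first exact: minimal_cocycle.
  case: n f uf => [|n] f uf /=; first by move=> x; rewrite subrr.
  by exists (fun=> 0); [exact: uHom0 | move=> x; rewrite subrr].
apply/funext => x; apply/eqP; rewrite -subr_eq0; apply/eqP.
case: n f uf g x gf => [|n] f uf g x /= gf; first exact: gf.
have [h uh ->] := gf; exact: uHom_JM0 uh (minimal_bd x mQ).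
Qed.

Lemma minimal_Ext n (c : set (Q n -> trivmod A)) :
  Ext c <-> exists2 f, uHom f & c = [set f].
Proof.
split=> [[f [uf fd] ->]|[f uf ->]]; first by exists f; rewrite ?minimal_ext_class.
by exists f; [exact: minimal_cocycle | rewrite minimal_ext_class].
Qed.

Lemma ext_add1 n (f g : Q n -> trivmod A) :
  ext_add [set f] [set g] = [set fun x => f x + g x].
Proof.
apply/seteqP; split=> [h [f' [g' [-> -> e]]]|h ->]; first exact/funext.
by exists f, g.
Qed.

(** [yoneda] ranges over all chain lifts; two of them differ by values in J P, which [g] kills. *)
Lemma minimal_yoneda (P : grres (trivmod A)) i n (g : P i -> trivmod A)
    (f : Q n -> trivmod A) phi : minimal P -> uHom g -> chain_lift f phi ->
  yoneda [set g] [set f] = [set fun x => g (phi i x)].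
Proof.
move=> mP ug lphi; have [uphi _ _] := lphi.
apply/seteqP; split=> [h [_ [_ [psi [-> -> lpsi]]]]|h ->].
  have [upsi _ _] := lpsi.
  rewrite minimal_ext_class; last exact: (uHom_comp ug (upsi i)).
  move=> ->; apply/funext => x; apply/eqP; rewrite -subr_eq0.
  rewrite -(linB (uHom_linear ug)); apply/eqP/uHom_JM0 => //.
  exact: (chain_lift_unique mP mQ lpsi lphi).
exists g, f, phi; split=> //.
by rewrite minimal_ext_class //; exact: (uHom_comp ug (uphi i)).
Qed.

Lemma minimal_JM_aug x : JM (aug x) -> JM (x : Q 0%N).
Proof.
move=> [n [a [m [am ax]]]].
have /choice [q qE] k : exists y : Q 0%N, aug y = m k by exact: aug_surj.
have J1 : JM (\sum_k a k *: q k).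
  by apply: JM_sum => k _; apply: JM_scale; have [] := am k.
rewrite -(subrK (\sum_k a k *: q k) x); apply: JMD => //.
apply: (mQ (i := 0%N)); rewrite /syz /= (linB (aug_hom Q).1) ax (lin_sum (aug_hom Q).1).
by rewrite -sumrB big1 // => k _; rewrite (linZ (aug_hom Q).1) qE subrr.
Qed.

(** [biKoszul] provides some minimal resolution; the degrees of generators are read modulo J and so
    pass to any other one. *)
Lemma minimal_transfer (Q' : grres M) l n S : minimal Q' -> below M l ->
  generated_in (Q' n) S -> generated_in (Q n) S.
Proof.
move=> mQ' bM gS; have [phi [psi [[hp _] [hq _] _ pq]]] := minimal_compare Q' mQ.
apply: (generated_of_JM (minimal_below mQ bM)) => j x xj jS.
have := gen_JM gS jS ((hp n).2 _ _ xj); move/(JM_hom (hq n).1) => h.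
by rewrite -(subrK (psi n (phi n x)) x); apply: JMD.
Qed.

(** Outside degree 0 the elements of Q_0 lie in J Q_0, and k sits in degree 0. Hence classes in
    E^0(M) lift to chain maps of degree 0. *)
Lemma uHom_Q0_gr (f : Q 0%N -> trivmod A) : Gr0 M -> uHom f -> gr_hom f.
Proof.
move=> gM uf; split=> [|j x xj]; first exact: uHom_linear.
have [j0|j0] := eqVneq j 0; last first.
  rewrite (uHom_JM0 uf) ?mcomp0 //; first exact: mcomp0.
  by apply/minimal_JM_aug/(gen_JM gM _ ((aug_hom Q).2 _ _ xj)); rewrite inE.
have [s [g [hg fE]]] := uf; rewrite fE; apply: mcomp_bigsum => n _.
have gx : @mcomp _ _ (trivmod A) (j - n) (g n x) by apply: (hg n).2.
have [jn|jn] := eqVneq (j - n) 0; first by rewrite j0 -jn.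
by rewrite (triv_degree jn gx); exact: mcomp0.
Qed.

End MinimalResolution.
End MinimalExt.

Section Necessity.
Variables (F : fieldType) (A : gralg F) (d : nat) (M : grmod A).
Variables (P : grres (trivmod A)) (Q : grres M).
Hypotheses (ssA : semisimple0 A) (kA : biKoszul_algebra A d) (gM : Gr0 M).
Hypotheses (mP : minimal P) (mQ : minimal Q).

Lemma Gr0_below : below M 0.
Proof. by apply: gen_below gM _ => s; rewrite inE => /eqP ->. Qed.

Lemma triv_below : below (trivmod A) 0.
Proof. by move=> j u j0; apply: triv_degree; rewrite lt_eqF. Qed.

Lemma biKoszul_algebra_gen n : generated_in (P n) (Delta d n).
Proof.
by have [P' mP' gP'] := kA; apply: minimal_transfer mP' triv_below (gP' n).
Qed.

Let T n := {p : (forall j, Q j -> P j) * (P n -> trivmod A) | gr_chain p.1 /\ uHom p.2}.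

Let value n (s : seq (T n)) : Q n -> trivmod A :=
  fun x => \sum_(t <- s) (sval t).2 ((sval t).1 n x).

Let value_uHom n (s : seq (T n)) : uHom (value s).
Proof.
apply: uHom_sum => t; have [[ht _] ut] := svalP t.
exact: uHom_comp ut (uHom_gr (ht n)).
Qed.

(* E(A) E^0(M): a class of degree 0 is lifted to a chain map Q -> P. *)
Let S n : set (set (Q n -> trivmod A)) := [set c | exists s : seq (T n), c = [set value s]].

(** For the product with [g]: if [psi] lifts h : P_n -> k to a chain map from the shifted [P] to
    [P], then psi_j o phi_{j+n} lifts h o phi_n. So [phi] is kept and h is replaced by g o psi_i. *)
Let S_submodule : E_submodule P S.
Proof.
split=> [n c [s ->]|n|n a b [s ->] [t ->]|i n a b /(minimal_Ext mP) [g ug ->] [s ->]].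
- by apply/(minimal_Ext mQ); exists (value s).
- exists [::]; rewrite minimal_ext_class //; last exact: uHom0.
  by congr [set _]; apply/funext => x; rewrite /value big_nil.
- exists (s ++ t); rewrite ext_add1; congr [set _].
  by apply/funext => x; rewrite /value big_cat.
have /choice [psi psiP] (t : T n) : exists psi, chain_lift (P := P) (sval t).2 psi.
  by apply: uHom_chain_lift; apply: minimal_cocycle => //; have [] := svalP t.
have lift : chain_lift (P := P) (value s)
    (fun j x => \sum_(t <- s) psi t j ((sval t).1 (j + n)%N x)).
  split=> [j|x|j x].
  - apply: uHom_sum => t; have [[ht _] _] := svalP t; have [upsi _ _] := psiP t.
    exact: uHom_comp (upsi j) (uHom_gr (ht _)).
  - rewrite (lin_sum (aug_hom P).1); apply: eq_bigr => t _.
    by have [_ -> _] := psiP t.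
  - rewrite (lin_sum (bd_hom P j).1); apply: eq_bigr => t _.
    by have [_ _ ->] := psiP t; have [[_ ht] _] := svalP t; rewrite ht.
rewrite (minimal_yoneda mQ mP ug lift).
have tP (t : T n) : gr_chain (sval t).1 /\ uHom (g \o psi t i).
  by have [ct _] := svalP t; split=> //; have [upsi _ _] := psiP t; apply: uHom_comp.
exists [seq exist _ ((sval t).1, g \o psi t i) (tP t) | t <- s].
congr [set _]; apply/funext => x; rewrite /value big_map (lin_sum (uHom_linear ug)).
by [].
Qed.

Lemma generated_biKoszul : E_generated_by_E0 P Q -> biKoszul d M.
Proof.
move=> gen; exists Q => // n.
apply: (generated_of_JM (minimal_below mQ Gr0_below)) => j x xj jD.
have [//|nJ] := pselect (JM x); exfalso.
have [g ug gx] := separate_JM ssA xj nJ.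
have : S [set g].
  rewrite (gen S S_submodule).
    by apply/(minimal_Ext mQ); exists g.
  move=> c /(minimal_Ext mQ) [f uf ->].
  have [phi [cphi p0]] := gr_chain_exists P (uHom_Q0_gr mQ gM uf)
    (fun x => (minimal_cocycle mQ uf).2 x).
  have tP : gr_chain phi /\ uHom (@aug _ _ _ P) by split=> //; apply/uHom_gr/aug_hom.
  exists [:: exist _ (phi, @aug _ _ _ P) tP]; congr [set _]; apply/funext => y.
  by rewrite /value big_seq1 /= p0.
move=> [s]; move=> /seteqP [/(_ g erefl) gE _]; apply: gx; rewrite gE /value big1 // => t _.
have [[ht _] ut] := svalP t; apply: (uHom_JM0 ut).
exact: gen_JM (biKoszul_algebra_gen n) jD ((ht n).2 _ _ xj).
Qed.

End Necessity.

(** * Finite dimensionality *)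

Section FiniteSpan.
Variables (F : fieldType) (A : algType F).

Section Span.
Variable M : lmodType A.

Definition Fsubspace (S : set M) : Prop :=
  [/\ S 0, forall x y, S x -> S y -> S (x + y) & forall (c : F) x, S x -> S (c%:A *: x)].

(** The module has scalars in A only, so F acts through [c%:A]. *)
Fixpoint fspan (s : seq M) : set M :=
  if s is e :: s' then [set x | exists (c : F) y, fspan s' y /\ x = c%:A *: e + y]
  else [set 0].

Lemma fspan_subspace s : Fsubspace (fspan s).
Proof.
elim: s => [|e s [S0 SD SZ]] /=.
  by split=> [//|x y -> ->|c x ->]; rewrite ?addr0 ?scaler0.
split=> [|x y [c [x' [Sx ->]]] [b [y' [Sy ->]]]|b x [c [y [Sy ->]]]].
- by exists 0, 0; rewrite !scale0r addr0.
- exists (c + b), (x' + y'); split; first exact: SD.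
  by rewrite !scalerDl addrACA.
- exists (b * c), (b%:A *: y); split; first exact: SZ.
  by rewrite scalerDr scalerA mulr_algl scalerA.
Qed.

Lemma fspan_mem s x : x \in s -> fspan s x.
Proof.
elim: s => //= e s IH; rewrite inE => /predU1P[->|/IH Sx].
  by exists 1, 0; rewrite !scale1r addr0; split=> //; have [] := fspan_subspace s.
by exists 0, x; rewrite !scale0r add0r.
Qed.

Lemma fspan_min (S : set M) s : Fsubspace S -> {in s, forall x, S x} -> fspan s `<=` S.
Proof.
move=> [S0 SD SZ]; elim: s => [|e s IH] Ss x /=; first by move=> ->.
move=> [c [y [sy ->]]]; apply: SD; first by apply/SZ/Ss; rewrite mem_head.
by apply: IH sy => z zs; apply: Ss; rewrite inE zs orbT.
Qed.

Lemma fspan_sub s t : {subset s <= t} -> fspan s `<=` fspan t.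
Proof. by move=> st; apply: (fspan_min (fspan_subspace t)) => x /st /fspan_mem. Qed.

(* Steinitz: eliminate the head of [s] with a vector having a nonzero coefficient on it. *)
Lemma fspan_family (I : eqType) (v : I -> M) s : (forall i, fspan s (v i)) ->
  exists t : seq I, forall i, fspan [seq v j | j <- t] (v i).
Proof.
elim: s v => [|e s IH] v sv; first by exists [::].
have /choice [c cP] i : exists c : F, exists2 y, fspan s y & v i = c%:A *: e + y.
  by have [c [y [sy vE]]] := sv i; exists c, y.
have [[i0 ci0]|c0] := pselect (exists i, c i != 0); last first.
  apply: IH => i; have [y sy ->] := cP i.
  have [->|ci] := eqVneq (c i) 0; first by rewrite !scale0r add0r.
  by case: c0; exists i.
have [S0 SD SZ] := fspan_subspace s.
have [i|t tP] := IH (fun i => v i - (c i / c i0)%:A *: v i0).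
  have [y sy vE] := cP i; have [y0 sy0 v0E] := cP i0.
  have -> : v i - (c i / c i0)%:A *: v i0 = y + (- (c i / c i0))%:A *: y0.
    rewrite {1}vE {1}v0E scalerDr scalerA mulr_algl scalerA divfK // opprD addrACA subrr add0r.
    by rewrite !scaleNr.
  by apply: SD => //; apply: SZ.
exists (i0 :: t) => i; set u := [seq v j | j <- _ :: _].
have [T0 TD TZ] := fspan_subspace u.
have u0 : fspan u (v i0) by apply: fspan_mem; rewrite mem_head.
rewrite -(subrK ((c i / c i0)%:A *: v i0) (v i)); apply: (TD); last exact: (TZ).
apply: fspan_min (tP i); first exact: fspan_subspace.
move=> _ /mapP[j jt ->]; apply: (TD); first by apply/fspan_mem/mem_behead/map_f.
by rewrite -scaleNr -scaleNr; apply: TZ.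
Qed.

Definition fin_span (X : set M) := exists s, X `<=` fspan s.

Lemma fin_span0 : fin_span [set 0].
Proof. by exists [::]. Qed.

End Span.

Section Maps.
Variables M N : lmodType A.

Lemma fspan_map (f : M -> N) s x : linear f -> fspan s x -> fspan [seq f y | y <- s] (f x).
Proof.
move=> lf; elim: s x => [|e s IH] x /=; first by move=> ->; rewrite (lin0 lf).
move=> [c [y [sy ->]]]; exists c, (f y); split; first exact: IH.
by rewrite lf.
Qed.

Lemma fspan_map_ex (f : M -> N) s y : linear f -> fspan [seq f y | y <- s] y ->
  exists2 x, fspan s x & f x = y.
Proof.
move=> lf; elim: s y => [|e s IH] y /=; first by move=> ->; exists 0; rewrite ?(lin0 lf).
move=> [c [z [/IH[x sx <-] ->]]]; exists (c%:A *: e + x); last by rewrite lf.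
by exists c, x.
Qed.

End Maps.

Lemma scale_algC (M : lmodType A) (c : F) (a : A) (x : M) :
  c%:A *: (a *: x) = a *: (c%:A *: x).
Proof. by rewrite !scalerA mulr_algl mulr_algr. Qed.

Lemma fspan_scale (M : lmodType A) (s : seq A^o) (t : seq M) a x :
  fspan s a -> fspan t x -> fspan [seq (b : A) *: y | b <- s, y <- t] ((a : A) *: x).
Proof.
set u := [seq _ | _ <- _, _ <- _] => sa tx; have [U0 UD UZ] := fspan_subspace u.
apply: (@fspan_min _ [set a : A^o | fspan u ((a : A) *: x)] s) sa => [|b bs] /=.
  split=> [|b c /= ub uc|c b /= ub].
  - by rewrite /mkset scale0r.
  - by rewrite /mkset scalerDl; apply: UD.
  - by rewrite /mkset -scalerA; apply: UZ.
apply: (@fspan_min _ [set y : M | fspan u ((b : A) *: y)] t) tx => [|y yt] /=.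
  split=> [|y z /= ub uc|c y /= ub].
  - by rewrite /mkset scaler0.
  - by rewrite /mkset scalerDr; apply: UD.
  - by rewrite /mkset -scale_algC; apply: UZ.
by apply: fspan_mem; apply/allpairsP; exists (b, y).
Qed.


End FiniteSpan.

(** * Local finiteness of A and of the resolution of k *)

Section LocallyFinite.
Variables (F : fieldType) (A : gralg F).
Implicit Types (M N Q : grmod A).

Lemma fin_span_smul (M : lmodType A) (I : set A) (X : set M) :
  @fin_span _ _ A^o I -> fin_span X -> fin_span (smul_set I X).
Proof.
move=> [s Is] [t Xt]; exists [seq (b : A) *: y | b <- s, y <- t].
have [S0 SD _] := fspan_subspace [seq (b : A) *: y | b <- s, y <- t].
apply: smul_set_ind => // a x /Is sa /Xt tx; exact: fspan_scale sa tx.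
Qed.

Lemma fin_dim_span (X : set A) : fin_dim X -> @fin_span _ _ A^o X.
Proof.
move=> [n [e [_ eX]]]; exists [seq (e i : A^o) | i <- enum 'I_n] => x /eX [c ->].
have [S0 SD SZ] := fspan_subspace [seq (e i : A^o) | i <- enum 'I_n].
apply: (big_ind (fspan [seq (e i : A^o) | i <- enum 'I_n])) => // i _.
rewrite -mulr_algl; apply: (SZ (c i) (e i)); apply: fspan_mem.
by apply: map_f; rewrite mem_enum.
Qed.

(** The product A_1 ... A_1 A_0 with [j] factors A_1: finitely spanned by construction, and equal to
    A_j once A is generated in degrees 0 and 1. *)
Fixpoint word (j : nat) : set (regmod A) :=
  if j is i.+1 then smul_set (@acomp F A 1%N) (word i) else @acomp F A 0%N.

Lemma word0 j : word j 0.
Proof.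
case: j => [|j] /=; first exact: (ids0 (acomp_sum A)).
exact: smul_set0.
Qed.

Lemma wordD j x y : word j x -> word j y -> word j (x + y).
Proof. by case: j => [|j] /=; [exact: (idsD (acomp_sum A)) | exact: smul_setD]. Qed.

Lemma wordM i j (x y : regmod A) : word i x -> word j y -> word (i + j)%N ((x : A) *: y).
Proof.
elim: i x => [|i IH] x /= xi yj.
  case: j y yj => [|j] y /=; first exact: (acompM (i := 0) (j := 0)).
  move: y; apply: smul_set_ind => [|u v|a u a1 uj].
  - by rewrite scaler0; exact: (word0 j.+1).
  - by rewrite scalerDr; exact: smul_setD.
  (* A factor from A_0 is absorbed by the leading factor from A_1. *)
  - by rewrite scalerA; apply: smul_set1 uj; have := acompM xi a1.
move: x xi; apply: smul_set_ind => [|u v|a u a1 ui].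
- by rewrite scale0r; exact: (word0 (i + j).+1).
- by rewrite scalerDl; exact: smul_setD.
- by rewrite -[_ *: u]/(a * (u : A)) -scalerA; apply: smul_set1 a1 _; exact: IH.
Qed.

Lemma word_span j : fin_dim (@acomp F A 0%N) -> fin_dim (@acomp F A 1%N) -> fin_span (word j).
Proof.
move=> f0 f1; elim: j => [|j IH] /=; first exact: fin_dim_span.
by apply: fin_span_smul IH; exact: fin_dim_span.
Qed.

Lemma generated01_word : generated01 A -> forall j, @acomp F A j `<=` word j.
Proof.
move=> gA.
(* The elements whose homogeneous parts are all words contain A_0 and A_1 and are closed under sums
   and products. *)
have E : [set a : A | forall j : nat, word j (gproj j (a : regmod A))] = setT.
  apply: gA => [a a0 j|a a1 j|a b Sa Sb j|a b Sa Sb n].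
  - have a0' : @mcomp _ _ (regmod A) 0 a by [].
    by rewrite (gproj_hom _ a0'); case: j => [|j] //=; exact: (word0 j.+1).
  - have a1' : @mcomp _ _ (regmod A) 1 a by [].
    rewrite (gproj_hom _ a1'); case: j => [|[|j]] /=; [exact: (word0 0)| |exact: (word0 j.+2)].
    rewrite -[a in X in _ X]mulr1; exact: smul_set1 a1 (acomp1 A).
  - by rewrite gprojD; apply: wordD.
  - have [s [us _ bE]] := gproj_sum (b : regmod A).
    rewrite [X in gproj _ X](_ : _ = (a : A) *: (b : regmod A)) // bE scaler_sumr gproj_bigsum.
    apply: big_ind => [||k _]; [exact: word0|exact: wordD|].
    rewrite (gproj_scale _ _ (gprojP k _)).
    case: k => k; last first.
      by have /= -> := gprojP (Negz k) (b : regmod A); rewrite scaler0; exact: word0.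
    have [kn|nk] := leqP k n.
      by rewrite -[in word n](subnK kn) subzn //; exact: wordM.
    rewrite (regmod_below _ (gprojP (n%:Z - k%:Z) (a : regmod A))); last by rewrite subr_lt0.
    by rewrite scale0r; exact: word0.
move=> j a aj; have : setT a by [].
rewrite -E => /(_ j); have aj' : @mcomp _ _ (regmod A) j a by [].
by rewrite (gproj_id aj').
Qed.

Hypothesis stA : standing_assumptions A.

Lemma acomp_span j : fin_span (@mcomp _ _ (regmod A) j).
Proof.
have [_ f0 f1 gA] := stA; case: j => j; last exact: fin_span0.
by have [s sP] := word_span j f0 f1; exists s => a /(generated01_word gA) /sP.
Qed.

Lemma fspan_mcomp M j (s : seq M) : {in s, forall x, mcomp j x} -> fspan s `<=` mcomp j.
Proof.
apply: fspan_min; split=> [|x y|c x xj]; [exact: mcomp0|exact: mcompD|].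
rewrite -[j]add0r; apply: mcompZ xj; apply: acompZ; exact: acomp1.
Qed.

(** Induction on the degree: Q_j is spanned by lifts of generators of p(Q_j) together with (J Q)_j,
    and the latter by products of A_{i+1} with Q_{j-i-1}, finitely many of which are nonzero. *)
Lemma fin_span_cover Q N (p : Q -> N) : gr_hom p -> (forall x, p x = 0 -> JM x) ->
  below Q 0 -> (forall j, fin_span (@mcomp _ _ N j)) -> forall j, fin_span (@mcomp _ _ Q j).
Proof.
move=> hp kp bQ fN.
have H (n : nat) : forall j : int, j < n%:Z -> fin_span (@mcomp _ _ Q j).
  elim: n => [|n IH] j jn; first by exists [::] => x; exact: bQ jn.
  have [s Ns] := fN j.
  (* The spanning vectors must lie in p(Q_j), and not merely in N_j, in order to be lifted. *)
  have [t tP] : exists t : seq Q, forall x, fspan [seq p (gproj j y) | y <- t] (p (gproj j x)).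
    by apply: (@fspan_family _ _ N _ (fun x => p (gproj j x)) s) => x; apply/Ns/hp.2/gprojP.
  have /choice [w wP] (i : nat) : exists w, forall (a : A) (m : Q), acomp i.+1 a ->
      mcomp (j - i.+1%:Z) m -> fspan w (a *: m).
    have [|u uP] := IH (j - i.+1%:Z).
      rewrite ltrBlDr; apply: lt_le_trans jn _.
      by rewrite -PoszD lez_nat addnS ltnS leq_addr.
    have [v vP] := acomp_span i.+1.
    exists [seq (b : A) *: y | b <- v, y <- u] => a m ai mi.
    by apply: fspan_scale; [exact: vP | exact: uP].
  (* Here j < n + 1, so for i > n the degree j - i - 1 is negative and [Q] vanishes there. *)
  pose W := flatten [seq w i | i <- iota 0 n.+1].
  have [S0 SD SZ] := fspan_subspace ([seq gproj j y | y <- t] ++ W).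
  exists ([seq gproj j y | y <- t] ++ W) => x xj.
  have := tP x; rewrite (gproj_id xj) (map_comp p (gproj j)).
  move=> /(fspan_map_ex hp.1)[y ys yx].
  have yj : mcomp j y.
    by apply: fspan_mcomp ys => _ /mapP[z _ ->]; exact: gprojP.
  have Jxy : JM (x - y) by apply: kp; rewrite (linB hp.1) yx subrr.
  rewrite -(subrK y x); apply: (SD); last first.
    by apply: fspan_sub ys => z; rewrite mem_cat => ->.
  rewrite -(gproj_id (mcompB xj yj)).
  apply: (JM_hom_ind S0 SD) (x - y) Jxy => i a m ai mi.
  have [ni|iN] := leqP i n.
    apply: fspan_sub (wP i a m ai mi) => z zw; rewrite mem_cat; apply/orP; right.
    by apply/flattenP; exists (w i) => //; apply: map_f; rewrite mem_iota.
  rewrite (bQ _ _ _ mi) ?scaler0 // subr_lt0; apply: lt_le_trans jn _.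
  by rewrite lez_nat; apply: leqW.
move=> j; apply: (H `|j|%N.+1); apply: le_lt_trans (ler_norm _) _.
by rewrite -abszE ltz_nat.
Qed.

Lemma triv_span j : fin_span (@mcomp _ _ (trivmod A) j).
Proof.
have [s sP] := acomp_span j; exists [seq top_pi a | a <- s] => _ [a aj <-].
exact/fspan_map/sP/aj/(top_pi_hom (regmod A)).1.
Qed.

Lemma resolution_span (P : grres (trivmod A)) n j : minimal P ->
  fin_span (@mcomp _ _ (P n) j).
Proof.
move=> mP; have bP i : below (P i) 0 by exact: (minimal_below mP (@triv_below F A)).
elim: n j => [|n IH].
  exact: (fin_span_cover (aug_hom P) (mP 0%N) (bP 0%N) triv_span).
exact: (fin_span_cover (bd_hom P n) (mP n.+1) (bP n.+1) IH).
Qed.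

End LocallyFinite.

(** * Strongly bi-Koszul implies generation of E(M) *)

Section DirectSumTotals.
Variables (F : fieldType) (A : gralg F) (I : choiceType).

Lemma dsum_JM (V : grmod A) (x : dsum I V) : (forall i, JM (dproj i x)) -> JM x.
Proof.
move=> h; rewrite (dsum_decomp x); apply: JM_sum => i _.
exact: JM_hom (dinj_hom V i).1 (h i).
Qed.

Lemma dsum_JM0 (V : grmod A) : (forall y : V, JM y -> y = 0) ->
  forall x : dsum I V, JM x -> x = 0.
Proof.
move=> h x Jx; apply: dsum_eq => i; rewrite (lin0 (dproj_hom V i).1).
exact/h/(JM_hom (dproj_hom V i).1).
Qed.

Lemma dtotal_map (V W X Y : grmod A) (p : V -> W) (q : X -> Y) (g : I -> V -> X)
    (h : I -> W -> Y) (x : dsum I V) :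
  gr_hom p -> gr_hom q -> (forall i, gr_hom (h i)) ->
  (forall i y, q (g i y) = h i (p y)) -> q (dtotal g x) = dtotal h (dmap p x).
Proof.
move=> hp hq hh e; have [ux hx] := dsuppP x.
rewrite (dtotalE hh ux) => [|i /hx xi]; last by rewrite (dmapE hp) xi (lin0 hp.1).
by rewrite (lin_sum hq.1); apply: eq_bigr => i _; rewrite (dmapE hp) e.
Qed.

End DirectSumTotals.

Section Sufficiency.
Variables (F : fieldType) (A : gralg F) (d : nat) (M : grmod A).
Variables (P : grres (trivmod A)).
Hypotheses (stA : standing_assumptions A) (kA : biKoszul_algebra A d) (gM : Gr0 M).
Hypotheses (mP : minimal P).

Let ssA : semisimple0 A. Proof. by have [] := stA. Qed.

Lemma top_degree (t : top M) : mcomp 0 t.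
Proof.
rewrite -[t]top_reprK; have [s [_ _ ->]] := gproj_sum (top_repr t).
rewrite (lin_sum (top_pi_hom M).1); apply: mcomp_bigsum => j _.
have [->|j0] := eqVneq j 0; first by apply: (top_pi_hom M).2; apply: gprojP.
have /top_pi_eq0 -> : JM (gproj j (top_repr t)).
  by apply: gen_JM gM _ (gprojP j _); rewrite inE.
exact: mcomp0.
Qed.

Lemma triv_mcomp0 (u : trivmod A) : mcomp 0 u.
Proof.
have [s [_ _ ->]] := gproj_sum u; apply: mcomp_bigsum => j _.
have [->|j0] := eqVneq j 0; first exact: gprojP.
by rewrite (triv_degree j0 (gprojP j u)); exact: mcomp0.
Qed.

(** The other parts of [x] are sent to nonzero degrees, where k vanishes. *)
Lemma hom_deg_triv (N : grmod A) m (g : N -> trivmod A) x : hom_deg m g -> g x = g (gproj m x).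
Proof.
move=> hg; have lg := hg.1; have [s [us s0 {1}->]] := gproj_sum x.
have g0 j : j != m -> g (gproj j x) = 0.
  move=> jm; apply: (@triv_degree _ _ (j - m)); first by rewrite subr_eq0.
  by apply: (hg.2 j); exact: gprojP.
rewrite (lin_sum lg); have [ms|ms] := boolP (m \in s).
  by rewrite (bigD1_seq m) //= big1 ?addr0.
rewrite (s0 _ ms) (lin0 lg) big_seq big1 // => j js; apply: g0.
by apply: contraNneq ms => <-.
Qed.

(* The map k -> M/JM sending 1 to t. *)
Definition triv_map (t : top M) (u : trivmod A) : top M := (top_repr u : A) *: t.

Lemma triv_mapE t (a : regmod A) : triv_map t (top_pi a) = (a : A) *: t.
Proof.
apply/eqP; rewrite -subr_eq0 -scalerBl; apply/eqP/JM_top.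
pose h (b : regmod A) : top M := (b : A) *: t.
have lh : linear h by move=> b x y; rewrite /h scalerDl -scalerA.
by apply: (JM_hom lh); apply/top_piE; rewrite top_reprK.
Qed.

Lemma triv_map_hom t : gr_hom (triv_map t).
Proof.
split=> [a u v|j u uj].
  rewrite -[u]top_reprK -[v]top_reprK -(top_pi_hom (regmod A)).1 !triv_mapE.
  by rewrite scalerDl -scalerA.
have [j0|j0] := eqVneq j 0; last first.
  by rewrite (triv_degree j0 uj) -(top_pi0 (regmod A)) triv_mapE scale0r; exact: mcomp0.
have [a aj <-] := uj; rewrite triv_mapE j0; rewrite j0 in aj.
by rewrite -[0]addr0; apply: regcompZ aj (top_degree t).
Qed.

Section TopResolution.
Variable R : grres (top M).
Hypothesis mR : minimal R.

(** The sum [kappa] of all maps k -> M/JM, 1 to t, is onto. Projectivity of R_0 lifts its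
    augmentation through [kappa], without splitting M/JM into simple modules; the lift kills
    boundaries, as its target is killed by J, and so extends to [alpha]. In turn [beta] lifts
    [kappa], and [beta] after [alpha] lifts the identity. *)
Lemma top_compare : exists (alpha : forall j, R j -> dsum (top M) (P j))
    (beta : forall j, dsum (top M) (P j) -> R j),
  [/\ gr_chain (P := dsum_res (top M) P) alpha, forall j, gr_hom (beta j)
    & forall j x, JM (x - beta j (alpha j x))].
Proof.
pose K := dsum (top M) (trivmod A).
pose kappa : K -> top M := dtotal triv_map.
have hk : gr_hom kappa by apply: dtotal_hom; exact: triv_map_hom.
have [t|f hf fE] := term_projective hk (aug_hom R).
  exists (dinj t (top_pi (1 : regmod A) : trivmod A)).
  rewrite /kappa (dtotal_one triv_map_hom (i := t)) => [|k kt]; last exact: dproj_neq.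
  by rewrite dprojK triv_mapE scale1r.
have [x|alpha [ca a0]] := gr_chain_exists (dsum_res (top M) P) hf.
  apply: (dsum_JM0 (@JM_top _ _ _)); apply: JM_hom hf.1 _; exact: minimal_bd.
pose D := dsum_res (top M) P.
have [x|beta [cb b0]] := gr_chain_exists R (gr_hom_comp hk (aug_hom D)).
  by rewrite /= -[RHS](lin0 hk.1); congr kappa; exact: (@aug_bd _ _ _ D).
exists alpha, beta; split=> //; first by case: cb.
apply: (gr_chain_id_JM mR (gr_chain_comp cb ca)) => x /=.
by rewrite b0 -(fE x) -(a0 x).
Qed.

Lemma top_below0 : below (top M) 0.
Proof.
move=> j u j0 uj; rewrite -(gproj_id uj) (gproj_hom j (top_degree u)).
by rewrite lt_eqF.
Qed.

Lemma top_resolution_gen n : generated_in (R n) (Delta d n).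
Proof.
have [alpha [beta [[ha _] hb ab]]] := top_compare.
apply: (generated_of_JM (minimal_below mR top_below0)) => j x xj jD.
rewrite -(subrK (beta n (alpha n x)) x); apply: JMD; first exact: ab.
apply: JM_hom (hb n).1 _; apply: dsum_JM => i.
apply: gen_JM (biKoszul_algebra_gen kA mP n) jD _.
by apply: (dproj_hom _ i).2; apply: (ha n).2.
Qed.

End TopResolution.

Section TopInjectivity.
Variables (Q : grres M) (mQ : minimal Q).

(* Outside n = 2 mod 3, Q_n and R_n are generated in a single degree, so only elements
   of that degree matter, and those are detected by the differential. *)
Lemma strongly_top_injective : strongly_biKoszul d M ->
  exists (R : grres (top M)) (Phi : forall j, Q j -> R j),
  [/\ minimal R, gr_chain Phi & forall n x, JM (Phi n x) -> JM x].
Proof.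
(* Three minimal resolutions of [M] meet: [Q2] has generators in the prescribed degrees, [Q1]
   carries the strong condition, and [Q] is the given one. *)
move=> [_ [Q2 mQ2 gQ2] [Q1 [R [phi [[mQ1 mR] hphi [bij0 _] bphi strong]]]]].
have gQ1 n : generated_in (Q1 n) (Delta d n).
  exact: (minimal_transfer mQ1 mQ2 (Gr0_below gM) (gQ2 n)).
have inj n : (forall x, JM (phi n x) -> JM x) -> forall x, phi n x = 0 -> x = 0.
  move=> tn; apply: (top_injective_injective ssA) tn => //; exact: term_projective.
have tinj : forall n x, JM (phi n x) -> JM x.
  elim=> [|n IH] x Jx.
    have [psi pK Kp] := bij0; have [m [a [r [ar rE]]]] := Jx.
    have -> : x = \sum_i a i *: psi (r i).
      rewrite -[x]pK rE -[RHS]pK (lin_sum (hphi 0%N).1).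
      by congr psi; apply: eq_bigr => i _; rewrite (linZ (hphi 0%N).1) Kp.
    by apply: JM_sum => i _; apply: JM_scale; have [] := ar i.
  (* By induction phi_n is injective, so such a y is a cycle, and minimality puts cycles in J. *)
  have ker y : phi n.+1 y = 0 -> JM y.
    move=> y0; apply: (mQ1 n.+1); apply: (inj n IH).
    by rewrite -bphi y0 (lin0 (bd_hom R n).1).
  have single delta : Delta d n.+1 = [:: delta] -> JM x.
    move=> De; have [s [_ _ ->]] := gproj_sum x; apply: JM_sum => j _.
    have [->|jd] := eqVneq j delta; last first.
      by apply: gen_JM (gQ1 n.+1) _ (gprojP j x); rewrite De inE.
    apply: ker; rewrite (gr_hom_proj _ _ (hphi _)).
    apply: (@JM_lowest _ _ _ delta) (gprojP _ _) (JM_proj _ Jx).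
    apply: gen_below (top_resolution_gen mR n.+1) _ => s'.
    by rewrite De inE => /eqP ->.
  have : (n.+1 %% 3 < 3)%N by rewrite ltn_mod.
  case E : (n.+1 %% 3)%N => [|[|[|//]]] _; try by apply: single; rewrite /Delta E.
  (* [syz] at index n is the syzygy of order n + 1 = 3m + 2, the one in the strong condition. *)
  have [m nE] : exists m, n = (3 * m + 1)%N.
    by exists (n.+1 %/ 3)%N; apply: succn_inj; rewrite {1}(divn_eq n.+1 3) E mulnC !addnS addn0.
  move: x Jx IH ker {single E}; rewrite {}nE; set i := (3 * m + 1)%N => x Jx IH ker.
  (* The strong condition rewrites phi(bd x) as a sum of a_l phi(bd z_l) with a_l in J; by
     injectivity of phi_i, x minus the sum of the a_l z_l is a cycle, hence in J. *)
  have : (smul_set (@radJ F A) (syz (Q := R) (i := i)) `&` (phi i @` syz (Q := Q1) (i := i)))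
      (phi i (bd x)).
    split; last by exists (bd x); first exact: syz_bd.
    rewrite -bphi; have [k [a [r [ar ->]]]] := Jx; exists k, a, (fun l => bd (r l)).
    split=> [l|]; first by split; [have [] := ar l | exact: syz_bd].
    by rewrite (lin_sum (bd_hom R i).1); apply: eq_bigr => l _; rewrite (linZ (bd_hom R i).1).
  rewrite -(strong m) => -[k [a [r [ar rE]]]].
  have /choice [z zE] l : exists z, phi i (bd z) = r l.
    by have [_ [y /syz_im[z <-] <-]] := ar l; exists z.
  have Jz : JM (\sum_l a l *: z l).
    by apply: JM_sum => l _; apply: JM_scale; have [] := ar l.
  rewrite -(subrK (\sum_l a l *: z l) x); apply: JMD => //; apply: (mQ1 i.+1).
  apply: (inj i IH); rewrite (linB (bd_hom Q1 i).1) (linB (hphi i).1) rE.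
  rewrite (lin_sum (bd_hom Q1 i).1) (lin_sum (hphi i).1) -sumrB big1 // => l _.
  by rewrite (linZ (bd_hom Q1 i).1) (linZ (hphi i).1) zE subrr.
have [gam [gam' [cg cg' _ gg]]] := minimal_compare Q1 mQ.
exists R, (fun j => phi j \o gam j); split=> //; first exact: gr_chain_comp.
move=> n x /tinj /(JM_hom (cg'.1 n).1) h.
by rewrite -(subrK (gam' n (gam n x)) x); apply: JMD.
Qed.

End TopInjectivity.
End Sufficiency.

Lemma fspan_coef (F : fieldType) (A : algType F) (M : lmodType A) (s : seq M) x :
  fspan s x -> exists c : nat -> F, x = \sum_(k < size s) (c k)%:A *: s`_k.
Proof.
elim: s x => [|e s IH] x /=; first by move=> ->; exists (fun=> 0); rewrite big_ord0.
move=> [c [y [/IH[b ->] ->]]]; exists (fun k => if k is k'.+1 then b k' else c).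
by rewrite big_ord_recl.
Qed.

(** * Factoring homogeneous classes through the resolution of k *)

Section Factorization.
Variables (F : fieldType) (A : gralg F) (d : nat) (M : grmod A).
Variables (P : grres (trivmod A)) (Q : grres M).
Hypotheses (stA : standing_assumptions A) (gM : Gr0 M).
Hypotheses (mP : minimal P) (mQ : minimal Q).

Lemma hom_deg_comp_gr (L N X : grmod A) m (g : N -> X) (f : L -> N) :
  hom_deg m g -> gr_hom f -> hom_deg m (g \o f).
Proof. by move=> hg /hom_deg_gr hf; rewrite -[m]add0r; apply: hom_deg_comp. Qed.

Lemma gr_hom_scale (N : grmod A) (c : F) : gr_hom (fun x : N => (c%:A : A) *: x).
Proof.
split=> [a x y|j x xj]; first by rewrite scalerDr scale_algC.
by rewrite -[j]add0r; apply: mcompZ xj; apply: acompZ; exact: acomp1.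
Qed.

(* The maps P_n -> k of degree m form a finite dimensional space over F. *)
Lemma hom_deg_family (I : eqType) n m (g : I -> P n -> trivmod A) (i0 : I) :
  (forall i, hom_deg m (g i)) -> exists (t : seq I) (c : I -> nat -> F),
  forall i x, g i x = \sum_(k < size t) (c i k)%:A *: g (nth i0 t k) x.
Proof.
move=> hg; have [s sP] := resolution_span stA n m mP.
have [u uP] := triv_span stA 0.
(* A map of degree m is determined by its values on the list [s] spanning P_n in degree m; [v i]
   records these values in a finitely spanned space, where the elimination applies. *)
pose W : lmodType A := {ffun 'I_(size s) -> trivmod A}.
pose v i : W := [ffun l : 'I_(size s) => g i s`_l].
pose del (l : 'I_(size s)) (y : trivmod A) : W := [ffun l' => if l' == l then y else 0].
have hdel l : linear (del l).
  move=> a x y; apply/ffunP => l'; rewrite !ffunE; case: ifP => // _.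
  by rewrite scaler0 addr0.
have vspan i : fspan (flatten [seq [seq del l y | y <- u] | l <- enum 'I_(size s)]) (v i).
  have [S0 SD _] := fspan_subspace
    (flatten [seq [seq del l y | y <- u] | l <- enum 'I_(size s)]).
  have -> : v i = \sum_l del l (g i s`_l).
    apply/ffunP => l; rewrite sum_ffunE !ffunE (bigD1 l) //= ffunE eqxx big1 ?addr0 // => l' ll.
    by rewrite ffunE eq_sym (negbTE ll).
  apply: big_ind => // l _.
  have := fspan_map (hdel l) (uP _ (triv_mcomp0 (g i s`_l))).
  apply: fspan_sub => w wl; apply/flattenP; exists [seq del l y | y <- u] => //.
  by apply: map_f; rewrite mem_enum.
have [t tP] := fspan_family vspan.
have /choice [c cP] i : exists c : nat -> F, v i = \sum_(k < size t) (c k)%:A *: v (nth i0 t k).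
  have [c ->] := fspan_coef (tP i); rewrite size_map; exists c.
  by apply: eq_bigr => k _; rewrite (nth_map i0).
exists t, c => i x.
rewrite (hom_deg_triv x (hg i)).
under eq_bigr do rewrite (hom_deg_triv x (hg _)).
move: (gproj m x) (sP _ (gprojP m x)).
apply: (@fspan_min _ _ _
  [set y | g i y = \sum_(k < size t) (c i k)%:A *: g (nth i0 t k) y]) => [|y /(nthP 0)[l ls <-]].
  split=> [|y z gy gz|b y gy]; rewrite /mkset.
  - rewrite (lin0 (hg i).1) big1 // => k _; by rewrite (lin0 (hg _).1) scaler0.
  - rewrite (linD (hg i).1) gy gz -big_split; apply: eq_bigr => k _.
    by rewrite (linD (hg _).1) scalerDr.
  - rewrite (linZ (hg i).1) gy scaler_sumr; apply: eq_bigr => k _.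
    by rewrite (linZ (hg _).1) scale_algC.
have := congr1 (fun w : W => w (Ordinal ls)) (cP i).
rewrite sum_ffunE !ffunE /= => ->; apply: eq_bigr => k _.
by rewrite !ffunE.
Qed.

Lemma hom_deg_factor (R : grres (top M)) (Phi : forall j, Q j -> R j) n m
    (f : Q n -> trivmod A) :
  minimal R -> gr_chain Phi -> (forall x, JM (Phi n x) -> JM x) -> hom_deg m f ->
  exists (r : nat) (h : nat -> P n -> trivmod A) (chi : nat -> forall j, Q j -> P j),
  [/\ forall k, uHom (h k), forall k, gr_chain (chi k)
    & forall x, f x = \sum_(k < r) h k (chi k n x)].
Proof.
move=> mR cPhi tPhi hf; have [ssA _ _ _] := stA.
have [alpha [beta [calpha hbeta ab]]] := top_compare P gM mR.
have [y Jy|q /tPhi Jq|g hg gE] :=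
  graded_extension (N := shift (trivmod A) m) ssA (cPhi.1 n) hf.
- exact: JM_top Jy.
- exact: uHom_JM0 (uHom_deg hf) Jq.
pose gt (t : top M) : P n -> trivmod A := g \o (beta n \o dinj t).
have hgt t : hom_deg m (gt t).
  exact: hom_deg_comp_gr hg (gr_hom_comp (hbeta n) (dinj_hom _ t)).
have [ts [c gc]] := hom_deg_family 0 hgt.
(* If g_t is the sum over k of c_{tk} g_{t_k}, then the sum over t of g_t(alpha_t) equals the sum
   over k of g_{t_k} applied to the sum over t of c_{tk} alpha_t. The inner sum is [chi k]: it is
   finite at each point, since alpha takes values in a direct sum. *)
pose chi k j (x : Q j) : P j :=
  dtotal (fun t y => ((c t k)%:A : A) *: y) (alpha j (Phi j x)).
have hsc k j (t : top M) : gr_hom (fun y : P j => ((c t k)%:A : A) *: y).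
  exact: gr_hom_scale.
have cchi k : gr_chain (chi k).
  split=> [j|j x].
    apply: (gr_hom_comp (f := dtotal _)); first by apply: dtotal_hom => t; exact: hsc.
    exact: gr_hom_comp (calpha.1 j) (cPhi.1 j).
  rewrite /chi -cPhi.2 -(calpha.2 j).
  exact: (dtotal_map _ (bd_hom P j) (bd_hom P j) (hsc k j)
    (fun t y => linZ (bd_hom P j).1 _ _)).
exists (size ts), (fun k => gt (nth 0 ts k)), chi; split=> // [k|x].
  exact: uHom_deg (hgt _).
rewrite -gE; set y := Phi n x.
have -> : g y = g (beta n (alpha n y)).
  apply/eqP; rewrite -subr_eq0 -(linB hg.1); apply/eqP.
  exact: uHom_JM0 (uHom_deg hg) (ab n y).
rewrite {1}(dsum_decomp (alpha n y)) (lin_sum (hbeta n).1) (lin_sum hg.1).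
transitivity (\sum_(t <- dsupp (alpha n y)) gt t (dproj t (alpha n y))); first by [].
under eq_bigr do rewrite gc.
rewrite exchange_big; apply: eq_bigr => k _ /=.
rewrite /chi /dtotal (lin_sum (hgt _).1); apply: eq_bigr => t _.
by rewrite (linZ (hgt _).1).
Qed.

(* Q (n + 0) and Q n are only propositionally equal. *)
Let cast m n (e : m = n) (x : Q m) : Q n := eq_rect m (fun k => Q k) x n e.

Let cast_uHom m n (e : m = n) (N : grmod A) (f : Q n -> N) : uHom f -> uHom (f \o cast e).
Proof. by case: _ / e f. Qed.

Let cast_bd m n (e : m = n) (e' : m.+1 = n.+1) (x : Q m.+1) : bd (cast e' x) = cast e (bd x).
Proof. by case: _ / e e' => e'; rewrite (eq_irrelevance e' erefl). Qed.

(** The chain map [chi] is itself a lift of the class aug o chi_0 in E^0(M), so h o chi_n is the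
    Yoneda product of [h] with that class. *)
Lemma E_submodule_chain (S : forall n, set (set (Q n -> trivmod A))) n
    (h : P n -> trivmod A) (chi : forall j, Q j -> P j) :
  E_submodule P S -> @Ext _ _ M Q (trivmod A) 0%N `<=` S 0%N ->
  uHom h -> gr_chain chi -> S n [set h \o chi n].
Proof.
move=> [_ _ _ SY] S0 uh [hchi bchi].
have uaug : uHom (@aug _ _ _ P \o chi 0%N).
  by apply/uHom_gr/gr_hom_comp => //; exact: aug_hom.
pose phi j (x : Q (j + 0)%N) := chi j (cast (addn0 j) x).
have lphi : chain_lift (P := P) (@aug _ _ _ P \o chi 0%N) phi.
  split=> [j|x|j x].
  - exact: (cast_uHom (addn0 j) (uHom_gr (hchi j))).
  - by rewrite /phi (eq_irrelevance (addn0 0) erefl).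
  - by rewrite /phi bchi -(cast_bd (addn0 j) (addn0 j.+1)).
have castS m k (e : m = k) (f : Q k -> trivmod A) : S m [set f \o cast e] -> S k [set f].
  by case: _ / e f.
apply: (castS _ _ (addn0 n)).
have <- : yoneda [set h] [set @aug _ _ _ P \o chi 0%N] = [set (h \o chi n) \o cast (addn0 n)].
  by rewrite (minimal_yoneda mQ mP uh lphi).
apply: SY; first by apply/(minimal_Ext mP); exists h.
by apply/S0/(minimal_Ext mQ); exists (@aug _ _ _ P \o chi 0%N).
Qed.

Lemma E_submodule_sum (S : forall n, set (set (Q n -> trivmod A))) n (I : Type) (s : seq I)
    (f : I -> Q n -> trivmod A) :
  E_submodule P S -> (forall i, S n [set f i]) -> S n [set fun x => \sum_(i <- s) f i x].
Proof.
move=> [_ S0 SD _] Sf; elim: s => [|i s IH].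
  have := S0 n; rewrite minimal_ext_class //; last exact: uHom0.
  by congr (S n [set _]); apply/funext => x; rewrite big_nil.
have := SD _ _ _ (Sf i) IH; rewrite ext_add1.
by congr (S n [set _]); apply/funext => x; rewrite big_cons.
Qed.

Lemma strongly_generated : biKoszul_algebra A d -> strongly_biKoszul d M ->
  E_generated_by_E0 P Q.
Proof.
move=> kA sM S SS S0 n.
have [R [Phi [mR cPhi tPhi]]] := strongly_top_injective stA kA gM mP mQ sM.
apply/seteqP; split; first by have [+ _ _ _] := SS; apply.
move=> c /(minimal_Ext mQ)[f [s [g [hg fE]]] ->].
have -> : f = fun x => \sum_(m <- s) g m x by exact/funext.
apply: (@E_submodule_sum S n _ s g SS) => m.
have [r [h [chi [uh cchi gE]]]] := hom_deg_factor mR cPhi (tPhi n) (hg m).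
have -> : g m = fun x => \sum_(k <- index_enum 'I_r) h k (chi k n x) by exact/funext.
apply: (@E_submodule_sum S n _ _ (fun (k : 'I_r) x => h k (chi k n x)) SS) => k.
exact: (E_submodule_chain SS S0 (uh k) (cchi k)).
Qed.

End Factorization.

Theorem theorem0p2 (F : fieldType) (A : gralg F) (d : nat) (M : grmod A)
    (P : grres (trivmod A)) (Q : grres M) :
  standing_assumptions A -> (2 <= d)%N -> biKoszul_algebra A d -> Gr0 M ->
  minimal P -> minimal Q ->
  (E_generated_by_E0 P Q -> biKoszul d M) /\
  (strongly_biKoszul d M -> E_generated_by_E0 P Q).
Proof.
move=> stA _ kA gM mP mQ; split; last exact: strongly_generated.
by apply: generated_biKoszul => //; case: stA.
Qed.
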